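(* Let $\Sigma$ be a signature, $\mathcal R$ a finite term rewriting system over $\Sigma$, and $G$ a finite initial E-graph over $\Sigma$. Let $\mathcal S$ be the relational schema, $\Gamma$ the set of dependencies over $\mathcal S$, and $I$ the initial database over $\mathcal S$ obtained from $\Sigma,\mathcal R,G$ by the encoding described in the context. Then the following three statements are equivalent: 1. Equality saturation terminates for $\mathcal R$ and $G$. 2. There exists a terminating chase sequence of the standard chase for $\Gamma$ and $I$. 3. All EGD-fair chase sequences of the standard chase for $\Gamma$ and $I$ terminate. Moreover, let $I_\infty$ denote the result of an arbitrary chase sequence of the standard chase for $\Gamma$ and $I$. If equality saturation terminates for $\mathcal R$ and $G$, then $I_\infty$ is isomorphic to the database encoding the E-graph $\mathrm{EqSat}(\mathcal R,G)$.
   Context: **E-graphs.** A signature $\Sigma$ is a finite set of function symbols with arities; $T(\Sigma)$ is the set of ground terms. A term rewriting system $\mathcal R$ is a set of rules $\mathit{lhs}\to\mathit{rhs}$ between patterns (terms with variables) with $\mathrm{Var}(\mathit{rhs})\subseteq\mathrm{Var}(\mathit{lhs})$. A (bottom-up) tree automaton $\mathcal A=\langle Q,\Sigma,\Delta\rangle$ (no final states) has a possibly infinite set $Q$ of states and a possibly infinite set $\Delta$ of transitions $f(q_1,\dots,q_n)\to q$. Viewing states as nullary symbols, $\to^*_{\mathcal A}$ is the reflexive-transitive closure of rewriting by $\Delta$ on $T(\Sigma\cup Q)$. $\mathcal A$ is deterministic if $s\to^*_{\mathcal A}q_1$ and $s\to^*_{\mathcal A}q_2$ ($s\in T(\Sigma)$,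 $q_i\in Q$) imply $q_1=q_2$, and reachable if every state $q$ satisfies $s\to^*_{\mathcal A}q$ for some $s\in T(\Sigma)$. An E-graph is a deterministic and reachable tree automaton; its states are called E-classes and its transitions E-nodes. A homomorphism is a map of states that sends transitions to transitions; $\mathcal A\sqsubseteq\mathcal B$ means a homomorphism $\mathcal A\to\mathcal B$ exists; this is a partial order on E-graphs up to isomorphism, with all least upper bounds $\bigsqcup$. $\mathrm{CC}(\mathcal A)$, for a reachable tree automaton $\mathcal A$, is the $\sqsubseteq$-least E-graph above $\mathcal A$. **Equality saturation.** For an E-graph $G$ with states $Q$, $T_{\mathcal R}(G)$ is the tree automaton obtained from $G$ by adding, for every rule $\mathit{lhs}\to\mathit{rhs}$ in $\mathcal R$, every $\sigma:\mathrm{Var}(\mathit{lhs})\to Q$ and $c\in Q$ with $\mathit{lhs}[\sigma]\to^*_G c$, the flattening of $s=\mathit{rhs}[\sigma]$ with root $c$: put $q_s=c$, $q_u=u$ for subterms $u\in Q$, a fresh state $q_u$ for every other proper subterm $u$ of $s$, and add the transition $f(q_{u_1},\dots,q_{u_k})\to q_u$ for every subterm $u=f(u_1,\dots,u_k)$ of $s$ with $f\in\Sigma$; if $s$ is itself a state, it is identified with $c$. Let $\mathrm{ICO}_{\mathcal R}=\mathrm{CC}\circ T_{\mathcal R}$ and $\mathrm{EqSat}(\mathcal R,G)=\bigsqcup_{i\ge0}\mathrm{ICO}^{(i)}_{\mathcal R}(G)$. Equality saturation terminates for $\mathcal R$ and $G$ if $\mathrm{ICO}^{(n)}_{\mathcal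 R}(G)$ is a fixpoint of $\mathrm{ICO}_{\mathcal R}$ (up to isomorphism) for some finite $n$. **Dependencies and the standard chase.** The domain of a database consists of constants and marked nulls. A homomorphism of instances is a map of domain elements that is the identity on constants and sends atoms to atoms. A TGD is a formula $\lambda(\vec x,\vec y)\to\exists\vec z\,\rho(\vec x,\vec z)$, and an EGD is a formula $\lambda(\vec x)\to x_i=x_j$ with $x_i,x_j$ in $\vec x$, where $\lambda,\rho$ are conjunctions of relational atoms over variables. A trigger for a dependency $d$ in an instance $I$ is a homomorphism $h$ from the body $\lambda$ to $I$. It is active if, for a TGD, $h$ has no extension to a homomorphism from $\rho(\vec x,\vec z)$ to $I$, and, for an EGD, $h(x_i)\ne h(x_j)$. $I$ is a model of a set of dependencies if there are no active triggers. A chase step $I\xrightarrow{d,h}J$ applies an active trigger $h$ of $d$ in $I$: for a TGD, add the atoms $h'(\rho(\vec x,\vec z))$, where $h'$ extends $h$ by mapping $\vec z$ to fresh marked nulls; for an EGD, if $h(x_i)$ (or $h(x_j)$) is a marked null, replace every occurrence of $h(x_i)$ with $h(x_j)$ (or of $h(x_j)$ with $h(x_i)$). A (standard) chase sequence starting at $I_0$ is a finite or infinite sequence of chase steps $I_0\xrightarrow{d_1,h_1}I_1\xrightarrow{d_2,h_2}\cdots$ that is fair: for all $i\ge0$, each dependency $d$ and each active trigger $h$ of $d$ in $I_i$, there is $j\ge i$ such that $h$ is no longer an active trigger of $d$ in $I_j$. It is terminating if it ends with some $I_n$ that is a model of $\Gamma$. The result of a chase sequence is $\bigcup_{i\ge0}\bigcap_{j\ge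 i}I_j$ (which is $I_n$ if it terminates at $I_n$). A chase sequence $I_0,I_1,\dots$ is EGD-fair if for every $i$, either $I_i$ is a model of $\Gamma$ and the chase terminates, or there is some $j>i$ such that $I_j$ is a model of the set of EGDs in $\Gamma$. **Encoding.** $\mathcal S$ has a relation symbol $R_f$ of arity $n+1$ for each $f\in\Sigma$ of arity $n$. The database encoding an E-graph has the E-classes as domain elements, all treated as marked nulls, and contains the atom $R_f(c_1,\dots,c_n,c)$ for each E-node $f(c_1,\dots,c_n)\to c$; $I$ is the encoding of $G$. $\Gamma$ contains, for each $f\in\Sigma$ of arity $n$, the EGD $R_f(x_1,\dots,x_n,x)\wedge R_f(x_1,\dots,x_n,x')\to x=x'$, and for each rule $\mathit{lhs}\to\mathit{rhs}$ the following dependency. Flatten a pattern by introducing a new variable $w_u$ for each non-variable subpattern $u$ (with $w_x=x$ for pattern variables $x$) and the atom $R_f(w_{u_1},\dots,w_{u_k},w_u)$ for each subpattern $u=f(u_1,\dots,u_k)$. If neither side is a variable, the dependency is the TGD whose body is the flattening of $\mathit{lhs}$ and whose head is the flattening of $\mathit{rhs}$, with the two root variables unified to one variable $r$, and with all other new variables of the head existentially quantified; e.g. $f(f(x,y),z)\to f(x,f(y,z))$ gives $R_f(x,y,w_1)\wedge R_f(w_1,z,r)\to\exists w_2.\ R_f(y,z,w_2)\wedge R_f(x,w_2,r)$. If $\mathit{lhs}$ is a single variable $x$, one dependency is introduced for each $f\in\Sigma$, with body $R_f(y_1,\dots,y_k,x)$ and root variable $r=x$. If $\mathit{rhs}$ is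 a single variable $x$, the dependency is the EGD with the same body and conclusion $x=r$, where $r$ is the root variable of $\mathit{lhs}$.
   Formalization: Chase sequences are also required to rename no element infinitely often by EGD steps (automatic for finite ones); with free choice of which null is replaced, statement 3 and the isomorphism can fail, e.g. for a→f(a), G={a→c}, where the result can be empty. *)

(* Defs.v *)
From Stdlib Require Import Relations ClassicalEpsilon.
From mathcomp Require Import all_boot.

Set Implicit Arguments.
Unset Strict Implicit.
Unset Printing Implicit Defensive.

(** * Terms *)

Record signature := Signature { symbol :> finType; arity : symbol -> nat }.

(* [term S V]: terms over [S] with leaves in [V].  Patterns are [term S nat],
   ground terms are [term S void], and T(Sigma U Q), where the states [Q] are
   nullary symbols, is [term S Q]. *)
Inductive term (S : signature) (V : Type) : Type :=
| Var (x : V)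
| App (f : S) (a : 'I_(arity f) -> term S V).
Arguments Var {S V} x.
Arguments App {S V} f a.

Notation pattern S := (term S nat).
Notation ground S := (term S void).

Fixpoint map_term (S : signature) (V W : Type) (s : V -> W) (t : term S V) :
    term S W :=
  match t with
  | Var x => Var (s x)
  | App f a => App f (fun i => map_term s (a i))
  end.

Inductive subterm (S : signature) (V : Type) (u : term S V) :
    term S V -> Prop :=
| subterm_refl : subterm u u
| subterm_arg f a i : subterm u (a i) -> subterm u (App f a).

Fixpoint occurs (S : signature) (x : nat) (p : pattern S) : bool :=
  match p with
  | Var y => x == y
  | App f a => [exists i, occurs x (a i)]
  end.

Lemma occurs_arg (S : signature) x (f : S) (a : 'I_(arity f) -> pattern S) i :
  occurs x (a i) -> occurs x (App f a).
Proof. by move=> xi; apply/existsP; exists i. Qed.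

(* [p] seen as a term over the subtype [P] of variables, when Var(p) is
   contained in [P]. *)
Fixpoint attach (S : signature) (P : pred nat) (p : pattern S) :
    (forall x, occurs x p -> P x) -> term S {x | P x} :=
  match p with
  | Var y => fun H => Var (exist (fun x => P x) y (H y (eqxx y)))
  | App f a => fun H =>
      App f (fun i => attach (fun x xi => H x (@occurs_arg S x f a i xi)))
  end.

Record rule (S : signature) := Rule {
  lhs : pattern S;
  rhs : pattern S;
  rule_vars : forall x, occurs x rhs -> occurs x lhs }.

(* Var(lhs), and both sides of a rule as terms over it. *)
Definition rvar S (r : rule S) := {x : nat | occurs x (lhs r)}.
Definition rlhs S (r : rule S) : term S (rvar r) := attach (fun x => id).
Definition rrhs S (r : rule S) : term S (rvar r) := attach (@rule_vars S r).

(** * Tree automata and E-graphs *)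

Record automaton (S : signature) := Automaton {
  state : Type;
  trans : forall f : S, ('I_(arity f) -> state) -> state -> Prop }.
Arguments trans {S} a f _ _.

Inductive rewrite1 S (A : automaton S) :
    term S (state A) -> term S (state A) -> Prop :=
| rewrite1_root f q c :
    trans A f q c -> rewrite1 (App f (fun i => Var (q i))) (Var c)
| rewrite1_arg f (a b : 'I_(arity f) -> term S (state A)) i :
    rewrite1 (a i) (b i) -> (forall j, j <> i -> b j = a j) ->
    rewrite1 (App f a) (App f b).

Definition runs S (A : automaton S) (t : term S (state A)) (q : state A) :=
  clos_refl_trans _ (@rewrite1 S A) t (Var q).

Definition accepts S (A : automaton S) (s : ground S) (q : state A) :=
  runs (map_term (@of_void (state A)) s) q.

Definition deterministic S (A : automaton S) :=
  forall (s : ground S) (q1 q2 : state A),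
    accepts s q1 -> accepts s q2 -> q1 = q2.

Definition reachable S (A : automaton S) :=
  forall q : state A, exists s : ground S, accepts s q.

Definition egraph S (A : automaton S) := deterministic A /\ reachable A.

(* As the signature is finite, an E-graph with finitely many states also has
   finitely many transitions. *)
Definition finite_states S (A : automaton S) :=
  exists s : seq (state A), forall q, List.In q s.

Definition ahom S (A B : automaton S) (h : state A -> state B) :=
  forall f q c, trans A f q c -> trans B f (fun i => h (q i)) (h c).

Definition below S (A B : automaton S) :=
  exists h : state A -> state B, ahom h.

Definition aiso S (A B : automaton S) :=
  exists2 h : state A -> state B, bijective h &
    forall f q c, trans A f q c <-> trans B f (fun i => h (q i)) (h c).

(* Least E-graphs are unique up to isomorphism only; [CC] and [lub] pick one
   of them. *)
Definition least_egraph S (P : automaton S -> Prop) (B : automaton S) :=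
  [/\ egraph B, P B & forall B', egraph B' -> P B' -> below B B'].

Definition CC S (A : automaton S) : automaton S :=
  epsilon (inhabits A) (least_egraph (below A)).

Definition lub S (A : nat -> automaton S) : automaton S :=
  epsilon (inhabits (A 0)) (least_egraph (fun B => forall i, below (A i) B)).

(* States are the equivalence classes of the equivalence generated by [E]. *)
Definition eqclass (X : Type) (E : X -> X -> Prop) (x : X) : X -> Prop :=
  clos_refl_sym_trans X E x.

Definition quotient S (A : automaton S) (E : state A -> state A -> Prop) :
    automaton S :=
  Automaton
    (state := {P : state A -> Prop | exists x, P = eqclass E x})
    (fun f Q Q0 => exists q q0,
      [/\ forall i, sval (Q i) = eqclass E (q i), sval Q0 = eqclass E q0
        & trans A f q q0]).

(** * Equality saturation *)

Section Saturation.
Context (S : signature) (R : seq (rule S)) (G : automaton S).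

Record redex := Redex {
  rx_rule : rule S;
  rx_in : List.In rx_rule R;
  rx_sub : rvar rx_rule -> state G;
  rx_root : state G;
  rx_runs : runs (map_term rx_sub (rlhs rx_rule)) rx_root }.

Definition rx_rhs (m : redex) : term S (state G) :=
  map_term (@rx_sub m) (rrhs (rx_rule m)).

Definition fresh_subterm (m : redex) (u : term S (state G)) :=
  [/\ subterm u (rx_rhs m), u <> rx_rhs m & forall q, u <> Var q].

Inductive tstate :=
| Old (q : state G)
| New (m : redex) (u : {u | fresh_subterm m u}).

(* [label m u q]: [q] is the state q_u in the flattening of [rx_rhs m].  The
   first two rules overlap exactly when [rx_rhs m] is itself a state. *)
Inductive label (m : redex) : term S (state G) -> tstate -> Prop :=
| label_root : label m (rx_rhs m) (Old (rx_root m))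
| label_state q : subterm (Var q) (rx_rhs m) -> label m (Var q) (Old q)
| label_new (u : {u | fresh_subterm m u}) : label m (sval u) (New u).

Inductive ttrans (f : S) : ('I_(arity f) -> tstate) -> tstate -> Prop :=
| ttrans_old q c : trans G f q c -> ttrans (fun i => Old (q i)) (Old c)
| ttrans_new m a q q0 :
    subterm (App f a) (rx_rhs m) ->
    (forall i, label m (a i) (q i)) -> label m (App f a) q0 ->
    ttrans q q0.

(* Two labels of the same subterm are identified; this only affects rules
   whose right-hand side is a variable. *)
Definition Tstep : automaton S :=
  @quotient S (Automaton ttrans)
    (fun q q' => exists m u, label m u q /\ label m u q').

Definition ICO : automaton S := CC Tstep.

End Saturation.

Definition ICO_iter S (R : seq (rule S)) (G : automaton S) (n : nat) :=
  iter n (ICO R) G.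

Definition EqSat S (R : seq (rule S)) (G : automaton S) : automaton S :=
  lub (ICO_iter R G).

Definition eqsat_terminates S (R : seq (rule S)) (G : automaton S) :=
  exists n, aiso (ICO R (ICO_iter R G n)) (ICO_iter R G n).

(** * Databases, dependencies and the standard chase *)

Record schema := Schema { rel : Type; rarity : rel -> nat }.

Record atom (T : schema) (X : Type) := Atom {
  arel : rel T;
  aargs : 'I_(rarity arel) -> X }.
Arguments Atom {T X} arel aargs.
Arguments aargs {T X} a _.

Definition map_atom T X Y (h : X -> Y) (a : atom T X) : atom T Y :=
  Atom (arel a) (fun i => h (aargs a i)).

Definition in_atom T X (x : X) (a : atom T X) := exists i, aargs a i = x.

Inductive value (C N : Type) := Const (c : C) | Null (n : N).
Arguments Const {C N} c.
Arguments Null {C N} n.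

Definition instance T C N := atom T (value C N) -> Prop.

Definition adom T C N (I : instance T C N) (v : value C N) :=
  exists a, I a /\ in_atom v a.

Definition instance_iso T C N N' (I : instance T C N) (J : instance T C N') :=
  exists h : {v | adom I v} -> {w | adom J w},
    [/\ bijective h,
        forall c v, sval v = Const c <-> sval (h v) = Const c
      & forall r (a : 'I_(rarity r) -> {v | adom I v}),
          I (Atom r (fun i => sval (a i))) <->
          J (Atom r (fun i => sval (h (a i))))].

(* The variables of the head of a TGD that do not occur in its body are
   existentially quantified. *)
Inductive dependency (T : schema) (X : Type) :=
| TGD (body head : seq (atom T X))
| EGD (body : seq (atom T X)) (x y : X).

Section Chase.
Context (T : schema) (X C N : Type).
Implicit Types (d : dependency T X) (I J : instance T C N)
  (h : X -> value C N).

Definition body_of d := match d with TGD b _ => b | EGD b _ _ => b end.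
Definition is_EGD d := match d with TGD _ _ => False | EGD _ _ _ => True end.

Definition in_atoms (b : seq (atom T X)) (x : X) :=
  exists a, List.In a b /\ in_atom x a.

Definition maps_into h (b : seq (atom T X)) I :=
  forall a, List.In a b -> I (map_atom h a).

(* Only the values of [h] on the variables of the body matter. *)
Definition trigger d h I := maps_into h (body_of d) I.

Definition extends (b : seq (atom T X)) h h' :=
  forall x, in_atoms b x -> h' x = h x.

Definition active d h I :=
  trigger d h I /\
  match d with
  | TGD b hd => ~ exists h', extends b h h' /\ maps_into h' hd I
  | EGD _ x y => h x <> h y
  end.

Definition model (Gam : dependency T X -> Prop) I :=
  forall d h, Gam d -> ~ active d h I.

(* [ren] is the effect of the step on the elements of [I]; the nulls
   introduced by a TGD step lie outside [used]. *)
Definition chase_step (used : value C N -> Prop) d h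
    (ren : value C N -> value C N) I J :=
  active d h I /\
  match d with
  | TGD b hd =>
      (forall v, ren v = v) /\
      exists h',
        [/\ extends b h h',
            forall z, in_atoms hd z -> ~ in_atoms b z ->
              exists n, h' z = Null n /\ ~ used (Null n),
            forall z z', in_atoms hd z -> ~ in_atoms b z ->
              in_atoms hd z' -> ~ in_atoms b z' -> h' z = h' z' -> z = z'
          & forall a, J a <->
              I a \/ exists a0, List.In a0 hd /\ a = map_atom h' a0]
  | EGD _ x y =>
      exists n v,
        [/\ (h x = Null n /\ h y = v) \/ (h y = Null n /\ h x = v),
            ren (Null n) = v,
            forall w, w <> Null n -> ren w = w
          & forall a, J a <-> exists a0, I a0 /\ a = map_atom ren a0]
  end.

(* The sequence is [ch_inst 0], ..., [ch_inst n] when [ch_len = Some n], and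
   infinite when [ch_len = None]; the data beyond [ch_len] is irrelevant. *)
Record sequence := Sequence {
  ch_len : option nat;
  ch_inst : nat -> instance T C N;
  ch_dep : nat -> dependency T X;
  ch_trig : nat -> X -> value C N;
  ch_ren : nat -> value C N -> value C N }.

Definition in_seq (s : sequence) (i : nat) : bool :=
  if ch_len s is Some n then i <= n else true.

Definition used_upto (s : sequence) (i : nat) (v : value C N) :=
  exists2 j, j <= i & adom (ch_inst s j) v.

Definition fair (Gam : dependency T X -> Prop) (s : sequence) :=
  forall i d h, in_seq s i -> Gam d -> active d h (ch_inst s i) ->
    exists j, [/\ i <= j, in_seq s j & ~ active d h (ch_inst s j)].

(* No element is renamed infinitely often by EGD steps: a constraint, void for
   finite sequences, on which of two nulls an EGD step replaces.  It holds for
   instance if the more recent null is always the one that is replaced.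
   Without it the union of intersections below need not be a limit of the
   instances, and a trigger can be postponed forever by renaming its elements.
   E.g. from {R_a(c)}, R_a(r) -> exists w, R_a(w) /\ R_f(w,r) and the EGD
   R_a(x) /\ R_a(x') -> x = x' have a fair infinite sequence in which every
   null eventually gets replaced by a more recent one; its result is empty. *)
Definition settles (s : sequence) :=
  forall i (v : nat -> value C N),
    in_seq s i -> adom (ch_inst s i) (v i) ->
    (forall j, i <= j -> in_seq s j.+1 -> v j.+1 = ch_ren s j (v j)) ->
    exists k, [/\ i <= k, in_seq s k
      & forall j, k <= j -> in_seq s j -> v j = v k].

Definition chase_sequence (Gam : dependency T X -> Prop) I (s : sequence) :=
  [/\ forall a, ch_inst s 0 a <-> I a,
      forall i, in_seq s i.+1 ->
        Gam (ch_dep s i) /\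
        chase_step (used_upto s i) (ch_dep s i) (ch_trig s i) (ch_ren s i)
          (ch_inst s i) (ch_inst s i.+1),
      fair Gam s
    & settles s].

Definition terminating (Gam : dependency T X -> Prop) (s : sequence) :=
  exists2 n, ch_len s = Some n & model Gam (ch_inst s n).

Definition EGD_fair (Gam : dependency T X -> Prop) (s : sequence) :=
  forall i, in_seq s i ->
    (model Gam (ch_inst s i) /\ terminating Gam s) \/
    exists j, [/\ i < j, in_seq s j
      & model (fun d => Gam d /\ is_EGD d) (ch_inst s j)].

Definition result (s : sequence) : instance T C N :=
  fun a => exists2 i, in_seq s i &
    forall j, i <= j -> in_seq s j -> ch_inst s j a.

End Chase.

(** * Encoding of E-graphs and rewrite rules *)

Definition rel_schema (S : signature) : schema :=
  @Schema S (fun f => (arity f).+1).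

Definition snoc n X (q : 'I_n -> X) (c : X) : 'I_n.+1 -> X :=
  fun i => if unlift ord_max i is Some j then q j else c.

Definition rel_atom (S : signature) X (f : S) (q : 'I_(arity f) -> X) (c : X) :
    atom (rel_schema S) X :=
  @Atom (rel_schema S) X f (snoc q c).

(* [i] embeds the E-classes into the nulls. *)
Definition encode S C N (G : automaton S) (i : state G -> N) :
    instance (rel_schema S) C N :=
  fun a => exists f q c, trans G f q c /\
    a = rel_atom (fun k => Null (i (q k))) (Null (i c)).

(* [LVar u] and [RVar u] are the variables w_u of the left- and right-hand
   side; keeping them apart makes the latter existential.  [ArgVar] and
   [ResVar] serve the remaining variables. *)
Inductive dvar (S : signature) :=
| PVar (x : nat)
| LVar (u : pattern S)
| RVar (u : pattern S)
| ArgVar (k : nat)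
| ResVar (b : bool).
Arguments PVar {S} x.
Arguments ArgVar {S} k.
Arguments ResVar {S} b.

Definition wvar S (w : pattern S -> dvar S) (u : pattern S) : dvar S :=
  match u with Var x => PVar x | App _ _ => w u end.

(* The flattening of [p], with [r] as the variable of the root. *)
Fixpoint flattening S (w : pattern S -> dvar S) (r : dvar S) (p : pattern S) :
    seq (atom (rel_schema S) (dvar S)) :=
  match p with
  | Var _ => [::]
  | App f a =>
      rel_atom (fun i => wvar w (a i)) r ::
      flatten [seq flattening w (wvar w (a i)) (a i) | i <- enum 'I_(arity f)]
  end.

Definition functional_EGD (S : signature) (f : S) : dependency (rel_schema S) (dvar S) :=
  EGD [:: rel_atom (f := f) (fun i => ArgVar i) (ResVar false);
          rel_atom (f := f) (fun i => ArgVar i) (ResVar true)]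
      (ResVar false) (ResVar true).

(* The bodies, with their root variables, for a left-hand side. *)
Definition rule_bodies S (l : pattern S) :
    seq (seq (atom (rel_schema S) (dvar S)) * dvar S) :=
  match l with
  | Var x =>
      [seq ([:: rel_atom (f := f) (fun i => ArgVar i) (PVar x)], PVar x)
         | f <- enum S]
  | App _ _ => [:: (flattening (@LVar S) (LVar l) l, LVar l)]
  end.

Definition rule_dependency S (p : pattern S)
    (b : seq (atom (rel_schema S) (dvar S)) * dvar S) :
    dependency (rel_schema S) (dvar S) :=
  match p with
  | Var x => EGD b.1 (PVar x) b.2
  | App _ _ => TGD b.1 (flattening (@RVar S) b.2 p)
  end.

Definition Gamma S (R : seq (rule S)) :
    seq (dependency (rel_schema S) (dvar S)) :=
  [seq functional_EGD f | f <- enum S] ++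
  flatten [seq [seq rule_dependency (rhs r) b | b <- rule_bodies (lhs r)]
             | r <- R].

Definition in_Gamma S (R : seq (rule S)) d := List.In d (Gamma R).

(* The initial instance; [nat] supplies the fresh nulls of the chase. *)
Definition initial S C (G : automaton S) :
    instance (rel_schema S) C (state G + nat)%type :=
  encode (C := C) (@inl (state G) nat).
Arguments initial {S} C G _.

Definition encoding S C (G : automaton S) :
    instance (rel_schema S) C (state G) :=
  encode (C := C) (fun q : state G => q).
Arguments encoding {S} C G _.

(* Main.v *)
(* An E-graph is determined, up to isomorphism, by the partial congruence
   "s and t evaluate to the same state" ([teq]) on ground terms, and A is below B
   iff [teq A] is contained in [teq B].  Let W ([cl R (teq G)]) be the least partial
   congruence that contains [teq G] and relates each instance of a left-hand side
   in its domain to the corresponding instance of the right-hand side.  Each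
   iterate of ICO lies below W and their union is W, so EqSat(R, G) represents W.
   Each instance of a chase sequence maps homomorphically into the ground terms
   modulo W.  As nulls are not renamed forever, the instances have a limit, which
   is the result; by fairness it is a model, so the result represents W as well.

   Each statement on termination is equivalent to W having finite index.  In that
   case W is finitely generated, and the generators show up at a finite stage:
   from then on the iterates of ICO, and those instances of a chase that satisfy
   the EGDs, represent W and are models.  Conversely, the iterates of ICO and the
   instances of the chase are finite, so that W has finite index when one of them
   represents it.  It remains to construct an EGD-fair chase sequence. *)

Require Import Defs.
From Stdlib Require Import Relations Classical ClassicalEpsilon.
From Stdlib Require Import FunctionalExtensionality PropExtensionality.
From Stdlib Require Import ProofIrrelevance.
From mathcomp Require Import all_boot.

Set Implicit Arguments.
Unset Strict Implicit.
Unset Printing Implicit Defensive.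

(** * Choice and finiteness *)

(** Between EGD steps an instance may violate the functional EGDs, and then its [teq] need not be
    transitive. Upper bounds are therefore obtained from homomorphisms into the ground terms, read
    modulo a congruence ([term_automaton], [term_hom]). No quotient is formed there, so a fresh
    state or null that stands for a subpattern can simply be sent to an instance of that subpattern.
    Lower bounds are claimed only for functional automata, where [teq] is a partial congruence and
    minimality of W applies.

    Partiality is what keeps W from containing terms that no iterate represents: congruence and
    rules apply only to terms in the domain, and the domain is closed under subterms.

    The sequence constructed at the end has to be fair, EGD-fair and settling at once. Finite lists
    of pending triggers, a finite cover of the active domain and a rank on nulls serve as the three
    decreasing measures. *)

Lemma fun_choice (A : Type) (B : A -> Type) (P : forall a, B a -> Prop) :
  (forall a, exists b, P a b) -> exists g : forall a, B a, forall a, P a (g a).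
Proof.
move=> H; exists (fun a => proj1_sig (constructive_indefinite_description _ (H a))).
by move=> a; case: constructive_indefinite_description.
Qed.

Lemma sig_inj (X : Type) (P : X -> Prop) (u v : {x | P x}) :
  sval u = sval v -> u = v.
Proof.
by case: u v => [x Hx] [y Hy] /= E; move: Hy; rewrite -E => Hy;
  rewrite (proof_irrelevance _ Hx Hy).
Qed.

Lemma In_cat X (s1 s2 : seq X) x :
  List.In x (s1 ++ s2) <-> List.In x s1 \/ List.In x s2.
Proof. exact: List.in_app_iff. Qed.

Lemma In_map X Y (g : X -> Y) s y :
  List.In y (map g s) <-> exists2 x, List.In x s & y = g x.
Proof.
elim: s => [|a s IH] /=; first by split=> // -[].
split; first by case=> [<-|/IH[x xs ->]]; [exists a; first left | exists x; first right].
by case=> x [->|xs] yE; [left | right; apply/IH; exists x].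
Qed.

Lemma In_flatten X (ss : seq (seq X)) x :
  List.In x (flatten ss) <-> exists2 s, List.In s ss & List.In x s.
Proof.
elim: ss => [|a ss IH] /=; first by split=> // -[].
rewrite In_cat IH; split.
  by case=> [xa|[s sss xs]]; [exists a => //; left | exists s => //; right].
by case=> s [->|sss] xs; [left | right; exists s].
Qed.

Lemma In_mem (X : eqType) (s : seq X) x : x \in s -> List.In x s.
Proof.
by elim: s => //= a s IH; rewrite inE => /orP[/eqP->|/IH]; [left | right].
Qed.

Lemma In_enum (X : finType) (x : X) : List.In x (enum X).
Proof. by apply: In_mem; rewrite mem_enum. Qed.

Lemma In_filter (X : Type) (P : X -> Prop) (s : seq X) : exists s',
  [/\ size s' <= size s, forall x, List.In x s' <-> List.In x s /\ P x
    & forall x, List.In x s -> ~ P x -> size s' < size s].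
Proof.
elim: s => [|a s [s' [le_s' s'P lt_s']]]; first by exists [::]; split=> // x; split=> // -[].
case: (classic (P a)) => Pa.
  exists (a :: s'); split=> // x /=; last by case=> [<- //|]; apply: lt_s'.
  rewrite s'P; split.
    by case=> [<-|[]]; [split; first left | split; first right].
  by case=> -[->|xs] Px; [left | right].
exists s'; split=> [|x /=|//]; first exact: leqW.
by rewrite s'P; split=> [[xs Px]|[[E|xs] Px]] //; [split; first right | case: Pa; rewrite E].
Qed.

(** The numbers become offsets of fresh nulls in [apply_TGD] and ranks of E-classes in
    [EGD_fair_ex]. *)
Lemma numbering (X : Type) (s : seq X) : exists m (idx : X -> nat),
  (forall x, List.In x s -> idx x < m) /\
  forall x y, List.In x s -> List.In y s -> idx x = idx y -> x = y.
Proof.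
elim: s => [|a s [m [idx [lt_m inj]]]]; first by exists 0, (fun=> 0); split=> // x [].
exists m.+1, (fun x => if excluded_middle_informative (x = a) then m else idx x).
have idxs x : List.In x (a :: s) -> x <> a -> List.In x s by case=> // ->.
split=> [x xs|x y xs ys]; first by case: excluded_middle_informative => // xa; apply/leqW/lt_m/idxs.
case: excluded_middle_informative => xa /=; case: excluded_middle_informative => ya //=.
- by rewrite xa ya.
- by move=> E; have := lt_m y (idxs y ys ya); rewrite -E ltnn.
- by move=> E; have := lt_m x (idxs x xs xa); rewrite E ltnn.
- by apply: inj; apply: idxs.
Qed.

Definition finp (X : Type) (P : X -> Prop) := exists l, forall x, P x -> List.In x l.

Lemma finp_sub X (P Q : X -> Prop) :
  finp Q -> (forall x, P x -> Q x) -> finp P.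
Proof. by case=> l lP PQ; exists l => x /PQ /lP. Qed.

Lemma finp_bigU X Y (P : X -> Prop) (Q : X -> Y -> Prop) :
  finp P -> (forall x, P x -> finp (Q x)) -> finp (fun y => exists2 x, P x & Q x y).
Proof.
case=> l lP QP.
suff [l' l'P] : finp (fun y => exists2 x, P x & List.In x l /\ Q x y).
  by exists l' => y [x Px Qxy]; apply: l'P; exists x => //; split=> //; apply: lP.
elim: l {lP} => [|a l [l' IH]]; first by exists [::] => y [x _ []].
case: (classic (P a)) => [/QP[la laP]|Pa].
  exists (la ++ l') => y [x Px [/= [E|xl] Qxy]]; apply/In_cat.
    by left; apply: laP; rewrite E.
  by right; apply: IH; exists x.
exists l' => y [x Px [/= [E|xl] Qxy]]; first by rewrite E in Pa.
by apply: IH; exists x.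
Qed.

Lemma finp_eq X (a : X) : finp (fun x => x = a).
Proof. by exists [:: a] => x ->; left. Qed.

Lemma finp_image X Y (P : X -> Prop) (g : X -> Y) :
  finp P -> finp (fun y => exists2 x, P x & y = g x).
Proof. by move=> finP; apply: finp_bigU => // x _; apply: finp_eq. Qed.

Lemma finp_In X (l : seq X) : finp (fun x => List.In x l).
Proof. by exists l. Qed.

Lemma finp_finType (X : finType) (P : X -> Prop) : finp P.
Proof. by exists (enum X) => x _; apply: In_enum. Qed.

Lemma finp_or X (P Q : X -> Prop) : finp P -> finp Q -> finp (fun x => P x \/ Q x).
Proof.
case=> l lP [l' l'Q]; exists (l ++ l') => x [/lP|/l'Q] xl; apply/In_cat; [by left | by right].
Qed.

Lemma finp_dfun n X (P : 'I_n -> X -> Prop) :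
  (forall i, finp (P i)) -> finp (fun g : 'I_n -> X => forall i, P i (g i)).
Proof.
elim: n P => [|n IH] P finP.
  case: (classic (exists g : 'I_0 -> X, True)) => [[g _]|noX].
    by exists [:: g] => g' _; left; apply: functional_extensionality => -[].
  by exists [::] => g' _; case: noX; exists g'.
have [//|l lP] := IH (fun i => P (lift ord0 i)).
pose cons (x : X) (g : 'I_n -> X) i := if unlift ord0 i is Some j then g j else x.
apply: (finp_sub (Q := fun g' => exists2 x, P ord0 x &
    exists2 g, List.In g l & g' = cons x g)).
  by apply: finp_bigU => // x _; apply: finp_image; apply: finp_In.
move=> g gP; exists (g ord0) => //.
exists (fun i => g (lift ord0 i)); first exact: lP.
apply: functional_extensionality => i; rewrite /cons.
by case: unliftP => [j|] ->.
Qed.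

(** Serves to list triggers: they are total maps on variables, so only their restrictions to the
    finitely many variables of a body can be enumerated. *)
Lemma finp_agree (X Y : Type) (P : Y -> Prop) (y0 : Y) (s : seq X) : finp P ->
  exists H : seq (X -> Y), forall h, (forall x, List.In x s -> P (h x)) ->
    exists2 h', List.In h' H & forall x, List.In x s -> h' x = h x.
Proof.
case=> l lP; elim: s => [|a s [H HP]].
  by exists [:: fun=> y0] => h _; exists (fun=> y0); first left.
pose upd (h : X -> Y) y x := if excluded_middle_informative (x = a) then y else h x.
exists (flatten [seq [seq upd h y | y <- l] | h <- H]) => h hs.
have [|h' h'H h'E] := HP h; first by move=> x xs; apply: hs; right.
exists (upd h' (h a)).
  apply/In_flatten; exists [seq upd h' y | y <- l]; first by apply/In_map; exists h'.
  by apply/In_map; exists (h a) => //; apply/lP/hs; left.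
move=> x xs; rewrite /upd; case: excluded_middle_informative => xa /=; first by rewrite xa.
by apply: h'E; case: xs => // ax; case: xa.
Qed.

(** * Evaluation of terms in tree automata *)

Section Evaluation.
Variable S : signature.

Fixpoint bind (V W : Type) (s : V -> term S W) (t : term S V) : term S W :=
  match t with
  | Var x => s x
  | App f a => App f (fun i => bind s (a i))
  end.

(** A relation, because evaluation may be undefined or multivalued: neither the automaton of [Tstep]
    nor an instance within a chase need be deterministic. *)
Fixpoint ev (A : automaton S) (V : Type) (s : V -> state A) (t : term S V)
    (q : state A) : Prop :=
  match t with
  | Var x => s x = q
  | App f a => exists2 p, trans A f p q & forall i, ev s (a i) (p i)
  end.

Definition gev (A : automaton S) (t : ground S) (q : state A) :=
  ev (@of_void (state A)) t q.

Fixpoint vin (V : Type) (x : V) (t : term S V) : Prop :=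
  match t with
  | Var y => x = y
  | App f a => exists i, vin x (a i)
  end.

Lemma vin_occurs x (p : pattern S) : vin x p <-> occurs x p.
Proof.
elim: p => [y|f a IH] /=; first by split=> [->//|/eqP].
split=> [[i /IH xi]|/existsP[i /IH xi]]; [by apply/existsP; exists i | by exists i].
Qed.

Lemma ev_map (A : automaton S) V W (s : W -> state A) (g : V -> W) t q :
  ev s (map_term g t) q <-> ev (fun x => s (g x)) t q.
Proof.
elim: t q => [x|f a IH] q //=; split; case=> p pq ap; exists p => // i; exact/IH.
Qed.

Lemma ev_eq (A : automaton S) V (s s' : V -> state A) t q :
  (forall x, vin x t -> s x = s' x) -> ev s t q -> ev s' t q.
Proof.
elim: t q => [x|f a IH] q /= E; first by rewrite E.
by case=> p pq ap; exists p => // i; apply: IH (ap i) => x xi; apply: E; exists i.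
Qed.

Lemma ev_hom (A B : automaton S) h V (s : V -> state A) t q :
  ahom (A := A) (B := B) h -> ev s t q -> ev (fun x => h (s x)) t (h q).
Proof.
move=> hom; elim: t q => [x|f a IH] q /=; first by move->.
by case=> p /hom pq ap; exists (fun i => h (p i)) => // i; apply: IH.
Qed.

Lemma gev_hom (A B : automaton S) h t q :
  ahom (A := A) (B := B) h -> gev t q -> gev t (h q).
Proof. by move=> hom /(ev_hom hom); apply: ev_eq => -[]. Qed.

Lemma ev_bind (A : automaton S) V W (s : V -> state A) (r : V -> term S W)
    (s' : W -> state A) t q :
  (forall x, vin x t -> ev s' (r x) (s x)) -> ev s t q -> ev s' (bind r t) q.
Proof.
elim: t q => [x|f a IH] q /= E; first by move<-; apply: E.
by case=> p pq ap; exists p => // i; apply: IH (ap i) => x xi; apply: E; exists i.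
Qed.

Lemma rewrite_args (A : automaton S) f (a b : 'I_(arity f) -> term S (state A)) :
  (forall i, clos_refl_trans _ (@rewrite1 S A) (a i) (b i)) ->
  clos_refl_trans _ (@rewrite1 S A) (App f a) (App f b).
Proof.
(* The arguments are rewritten one position after the other; in [c s] those at the positions in [s]
   are done. *)
move=> ab; pose c (s : seq 'I_(arity f)) i := if i \in s then b i else a i.
suff cP s : clos_refl_trans _ (@rewrite1 S A) (App f a) (App f (c s)).
  have -> : b = c (enum 'I_(arity f)); last exact: cP.
  by apply: functional_extensionality => i; rewrite /c mem_enum.
elim: s => [|i s IH].
  have -> : c [::] = a by apply: functional_extensionality.
  exact: rt_refl.
apply: rt_trans IH _; case: (boolP (i \in s)) => [is_s|is_s].
  have -> : c (i :: s) = c s; last exact: rt_refl.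
  apply: functional_extensionality => j; rewrite /c inE.
  by case: eqP => // ->; rewrite is_s.
pose d x j := if j == i then x else c s j.
have <- : d (a i) = c s.
  apply: functional_extensionality => j; rewrite /d; case: eqP => // ->.
  by rewrite /c (negbTE is_s).
have <- : d (b i) = c (i :: s).
  by apply: functional_extensionality => j; rewrite /d /c inE; case: eqP => // ->.
elim: (ab i) => {ab} [x y xy|x|x y z _ IH1 _ IH2].
- apply: rt_step; apply: (@rewrite1_arg _ _ _ _ _ i); rewrite /d ?eqxx //.
  by move=> j /eqP/negbTE->.
- exact: rt_refl.
- exact: rt_trans IH1 IH2.
Qed.

Lemma rewrite1_ev (A : automaton S) (t t' : term S (state A)) q :
  rewrite1 t t' -> ev id t' q -> ev id t q.
Proof.
move=> tt'; elim: tt' q => {t t'} [f p c pc|f a b i _ IH ab] q /=.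
  by move<-; exists p.
case=> p pq bp; exists p => // j; case: (eqVneq j i) => [->|/eqP/ab<-//].
exact: IH (bp i).
Qed.

Lemma runsP (A : automaton S) (t : term S (state A)) q : runs t q <-> ev id t q.
Proof.
split.
  rewrite /runs => /clos_rt_rt1n_iff; move E: (Var q) => u tu.
  by elim: tu E => [x <-//|x y z xy _ IH /IH]; apply: rewrite1_ev.
elim: t q => [x|f a IH] q /=; first by move->; apply: rt_refl.
case=> p pq ap; apply: (@rt_trans _ _ _ (App f (fun i => Var (p i)))).
  by apply: rewrite_args => i; apply: IH.
exact/rt_step/rewrite1_root.
Qed.

Lemma runs_map (A : automaton S) V (s : V -> state A) t q :
  runs (map_term s t) q <-> ev s t q.
Proof. by rewrite runsP ev_map. Qed.

Lemma acceptsP (A : automaton S) t (q : state A) : accepts t q <-> gev t q.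
Proof. exact: runs_map. Qed.

Definition functional (A : automaton S) :=
  forall f p (c c' : state A), trans A f p c -> trans A f p c' -> c = c'.

Lemma functional_ev (A : automaton S) V (s : V -> state A) t q q' :
  functional A -> ev s t q -> ev s t q' -> q = q'.
Proof.
move=> fA; elim: t q q' => [x|f a IH] q q' /=; first by move=> -> ->.
case=> p pq ap [p' pq' ap']; suff E : p = p' by apply: fA pq _; rewrite E.
by apply: functional_extensionality => i; apply: IH (ap i) (ap' i).
Qed.

Lemma functional_ev_bind (A : automaton S) V W (s : V -> state A)
    (r : V -> term S W) (s' : W -> state A) t q :
  functional A -> (forall x, vin x t -> ev s' (r x) (s x)) ->
  ev s' (bind r t) q -> ev s t q.
Proof.
move=> fA; elim: t q => [x|f a IH] q /= E.
  by move=> rq; apply: functional_ev fA (E x _) rq.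
by case=> p pq ap; exists p => // i; apply: IH (ap i) => x xi; apply: E; exists i.
Qed.

Lemma ev_bind_vin (A : automaton S) V W (r : V -> term S W) (s' : W -> state A) t q x :
  ev s' (bind r t) q -> vin x t -> exists q', ev s' (r x) q'.
Proof.
elim: t q => [y|f a IH] q /=; first by move=> rq ->; exists q.
by case=> p _ ap [i]; apply: IH (ap i).
Qed.

Lemma ev_subterm (A : automaton S) V (s : V -> state A) t u q :
  subterm u t -> ev s t q -> exists q', ev s u q'.
Proof.
move=> ut; elim: ut q => [q uq|f a i _ IH q [p _ ap]]; first by exists q.
exact: IH (ap i).
Qed.

(** Determinism concerns ground terms only. Reachability extends it to transitions: two results of
    f(p) are both values of f(t), where the terms t reach the states p. *)
Lemma egraphP (A : automaton S) :
  egraph A <-> functional A /\ forall q, exists t, @gev A t q.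
Proof.
split=> [[det reach]|[fA reach]].
  have reach' q : exists t, @gev A t q.
    by have [t /acceptsP] := reach q; exists t.
  split=> // f p c c' pc pc'.
  have [t tp] := fun_choice (fun i => reach' (p i)).
  by apply: (det (App f t)); apply/acceptsP; exists p.
split=> [t q q' /acceptsP tq /acceptsP|q]; first exact: functional_ev tq.
by have [t /acceptsP] := reach q; exists t.
Qed.

Definition teq (A : automaton S) (t t' : ground S) :=
  exists2 q, @gev A t q & @gev A t' q.

Lemma teq_refl (A : automaton S) t (q : state A) : gev t q -> teq A t t.
Proof. by exists q. Qed.

End Evaluation.

(** * E-graphs as partial congruences on ground terms *)

Section Congruences.
Variable S : signature.
Implicit Types (A B : automaton S) (P Q U : ground S -> ground S -> Prop).

(** The premise of [per_cong] keeps congruence from adding terms to the domain, except those related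
    to a term that is already there; [per_arg] closes the domain under subterms. *)
Record per P : Prop := Per {
  per_sym : forall s t, P s t -> P t s;
  per_trans : forall s t u, P s t -> P t u -> P s u;
  per_arg : forall f a i, P (App f a) (App f a) -> P (a i) (a i);
  per_cong : forall f a b, P (App f a) (App f a) -> (forall i, P (a i) (b i)) ->
    P (App f a) (App f b) }.

(** A rule fires only on an instance of the left-hand side in the domain, as a redex requires a run;
    it then brings the right-hand side into the domain. *)
Definition closed (R : seq (rule S)) P := forall r s, List.In r R ->
  P (bind s (lhs r)) (bind s (lhs r)) -> P (bind s (lhs r)) (bind s (rhs r)).

Inductive cl (R : seq (rule S)) U : ground S -> ground S -> Prop :=
| cl_base s t : U s t -> cl R U s t
| cl_sym s t : cl R U s t -> cl R U t s
| cl_trans s t u : cl R U s t -> cl R U t u -> cl R U s u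
| cl_arg f a i : cl R U (App f a) (App f a) -> cl R U (a i) (a i)
| cl_cong f a b : cl R U (App f a) (App f a) ->
    (forall i, cl R U (a i) (b i)) -> cl R U (App f a) (App f b)
| cl_rule r s : List.In r R -> cl R U (bind s (lhs r)) (bind s (lhs r)) ->
    cl R U (bind s (lhs r)) (bind s (rhs r)).

Definition sub_rel P Q := forall s t, P s t -> Q s t.

Lemma cl_per R U : per (cl R U).
Proof. split; [exact: cl_sym | exact: cl_trans | exact: cl_arg | exact: cl_cong]. Qed.

Lemma cl_closed R U : closed R (cl R U).
Proof. by move=> r s rR; apply: cl_rule. Qed.

Lemma cl_min R U P : per P -> closed R P -> sub_rel U P -> sub_rel (cl R U) P.
Proof.
move=> perP RP UP s t; elim=> {s t}.
- exact: UP.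
- by move=> s t _; apply: per_sym.
- by move=> s t u _ st _; apply: per_trans st.
- by move=> f a i _; apply: per_arg.
- by move=> f a b _ Pa _; apply: per_cong.
- by move=> r s rR _; apply: RP.
Qed.

Lemma per_refl P s t : per P -> P s t -> P s s.
Proof. by move=> perP st; apply: per_trans st (per_sym perP st). Qed.

Lemma per_subterm P s u : per P -> P s s -> subterm u s -> P u u.
Proof.
move=> perP + us; elim: us => // f a i _ IH Pfa; apply: IH.
exact: per_arg Pfa.
Qed.

Lemma teq_per A : functional A -> per (teq A).
Proof.
move=> fA; split.
- by move=> s t [q sq tq]; exists q.
- move=> s t u [q sq tq] [q' tq' uq']; exists q => //.
  by rewrite (functional_ev fA tq tq').
- by move=> f a i [q [p _ ap] _]; exists (p i); apply: ap.
- move=> f a b [q [p pq ap] _] ab; exists q; first by exists p.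
  exists p => // i; have [q' aq' bq'] := ab i.
  by rewrite (functional_ev fA (ap i) aq').
Qed.

(** A homomorphism has no freedom: it must send a state to the value in [B] of any term that reaches
    it. [A] may be nondeterministic, as required for the automata to which [CC] is applied. *)
Lemma below_teq A B : functional B -> (forall q, exists t, @gev S A t q) ->
  below A B <-> sub_rel (teq A) (teq B).
Proof.
move=> fB reach; split.
  by case=> h hom s t [q sq tq]; exists (h q); apply: gev_hom.
move=> AB; have [rep repP] := fun_choice reach.
have repB q : exists q', @gev S B (rep q) q'.
  by have [q' q'P _] := AB _ _ (teq_refl (repP q)); exists q'.
have [h hP] := fun_choice repB; exists h => f p c pc.
have [q' [p' pq' ap'] cq'] : teq B (App f (fun i => rep (p i))) (rep c).
  by apply: AB; exists c => //; exists p => // i; apply: repP.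
have -> : h c = q' by apply: functional_ev fB (hP c) cq'.
suff -> : (fun i => h (p i)) = p' by [].
by apply: functional_extensionality => i; apply: functional_ev fB (hP _) (ap' i).
Qed.

(** Both composites of the two homomorphisms preserve values of terms, and every state is such a
    value. *)
Lemma aiso_teq A B : egraph A -> egraph B ->
  sub_rel (teq A) (teq B) -> sub_rel (teq B) (teq A) -> aiso A B.
Proof.
move=> /egraphP[fA rA] /egraphP[fB rB] /(below_teq fB rA)[h hP].
move=> /(below_teq fA rB)[g gP].
have hK : cancel h g.
  move=> q; have [t tq] := rA q.
  exact: functional_ev fA (gev_hom gP (gev_hom hP tq)) tq.
have gK : cancel g h.
  move=> q; have [t tq] := rB q.
  exact: functional_ev fB (gev_hom hP (gev_hom gP tq)) tq.
exists h; first by exists g.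
move=> f p c; split; first exact: hP.
move/gP; rewrite hK; congr (trans A f _ c).
by apply: functional_extensionality => i; apply: hK.
Qed.

Definition class_automaton P : automaton S :=
  Automaton
    (state := {X : ground S -> Prop | exists2 t, P t t & X = P t})
    (fun f q c => exists a, [/\ forall i, sval (q i) = P (a i),
       P (App f a) (App f a) & sval c = P (App f a)]).

Lemma per_class P s t : per P -> P t t -> P s = P t <-> P s t.
Proof.
move=> perP tt; split=> [->//|st].
apply: functional_extensionality => u; apply: propositional_extensionality.
by split; apply: per_trans => //; apply: per_sym.
Qed.

Lemma class_automatonP P : per P ->
  egraph (class_automaton P) /\ forall s t, teq (class_automaton P) s t <-> P s t.
Proof.
move=> perP.
(* The terms in the domain are exactly those that evaluate, each to its own class. *)
have evP t (q : state (class_automaton P)) : gev t q <-> P t t /\ sval q = P t.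
  elim: t q => [[]|f a IH] q /=; split.
    case=> p [b [pb Pb qb]] ap.
    have Pba : P (App f b) (App f a).
      apply: per_cong => // i; have [Pa pa] := (IH i (p i)).1 (ap i).
      by apply/per_class; rewrite // -pb.
    have Pab := per_sym perP Pba.
    by split; [apply: per_refl Pab | rewrite qb; apply/per_class => //; apply: per_refl Pab].
  case=> Pa qa.
  have Pai i : P (a i) (a i) by apply: per_arg Pa.
  pose p i : state (class_automaton P) :=
    exist _ (P (a i)) (ex_intro2 _ _ (a i) (Pai i) erefl).
  exists p => [|i]; first by exists a.
  by apply/IH.
split.
  apply/egraphP; split.
    move=> f p c c' [a [pa Pa ca]] [b [pb Pb cb]]; apply: sig_inj.
    rewrite ca cb; apply/per_class => //; apply: per_cong => // i.
    by apply/(per_class (a i) perP (per_arg perP i Pb)); rewrite -pa -pb.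
  by case=> X [t Pt Xt]; exists t; apply/evP.
move=> s t; split.
  by case=> q /evP[_ qs] /evP[Pt qt]; apply/per_class; rewrite // -qs.
move=> st; have Ps := per_refl perP st.
exists (exist _ (P s) (ex_intro2 _ _ s Ps erefl)); apply/evP; split=> //=.
  exact: per_refl (per_sym perP st).
by apply/per_class => //; apply: per_refl (per_sym perP st).
Qed.

(** The common core of [CC] and [lub]: being above something means containing a relation [U]. The
    class automaton of the partial congruence generated by [U], with no rules, is a least such
    E-graph; this shows that [epsilon] has something to choose and determines [teq] of its
    choice. *)
Lemma least_egraphP (K : automaton S -> Prop) U A0 :
  (forall B, egraph B -> K B <-> sub_rel U (teq B)) ->
  let B := epsilon (inhabits A0) (least_egraph K) in
  egraph B /\ forall s t, teq B s t <-> cl [::] U s t.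
Proof.
move=> KU B.
have [eC teqC] := class_automatonP (cl_per [::] U).
have below_min B' : egraph B' -> K B' -> sub_rel (cl [::] U) (teq B').
  move=> eB' /(KU _ eB'); apply: cl_min => //.
  by case/egraphP: eB' => fB' _; apply: teq_per.
have [eB KB leB] : least_egraph K B.
  apply: epsilon_spec; exists (class_automaton (cl [::] U)); split=> //.
    by apply/KU => // s t st; apply/teqC/cl_base.
  move=> B' eB' KB'; case/egraphP: (eB') => fB' _.
  apply/below_teq => //; first by case/egraphP: eC.
  by move=> s t /teqC; apply: below_min.
split=> // s t; split; last exact: below_min.
have /leB : K (class_automaton (cl [::] U)).
  by apply/KU => // s' t' st; apply/teqC/cl_base.
case/egraphP: eB => _ rB; case/egraphP: (eC) => fC _.
by move=> /(_ eC)/(below_teq fC rB) BC /BC/teqC.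
Qed.

Lemma CC_P A : (forall q, exists t, @gev S A t q) ->
  egraph (CC A) /\ forall s t, teq (CC A) s t <-> cl [::] (teq A) s t.
Proof.
move=> rA; apply: least_egraphP => B /egraphP[fB _]; exact: below_teq.
Qed.

Lemma lub_P (A : nat -> automaton S) : (forall n, egraph (A n)) ->
  egraph (lub A) /\
  forall s t, teq (lub A) s t <-> cl [::] (fun s t => exists n, teq (A n) s t) s t.
Proof.
move=> eA; apply: least_egraphP => B /egraphP[fB _]; split.
  by move=> AB s t [n]; apply: (below_teq fB _).1 (AB n) s t; case/egraphP: (eA n).
move=> AB n; apply/below_teq => //; first by case/egraphP: (eA n).
by move=> s t st; apply: AB; exists n.
Qed.

End Congruences.

(** * Substitutions, and homomorphisms into the ground terms *)

Section Terms.
Variable S : signature.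

Lemma subterm_trans V (t u v : term S V) : subterm t u -> subterm u v -> subterm t v.
Proof. by move=> tu; elim=> // f a i _; apply: subterm_arg. Qed.

Lemma subterm_App V (f : S) (a : 'I_(arity f) -> term S V) i : subterm (a i) (App f a).
Proof. exact/subterm_arg/subterm_refl. Qed.

Lemma subterm_bind V W (r : V -> term S W) u t :
  subterm u t -> subterm (bind r u) (bind r t).
Proof.
elim=> [|f a i _ IH] /=; first exact: subterm_refl.
exact: (@subterm_arg _ _ _ _ (fun i => bind r (a i)) i).
Qed.

Lemma bind_map U V W (r : V -> term S W) (g : U -> V) t :
  bind r (map_term g t) = bind (fun x => r (g x)) t.
Proof.
by elim: t => //= f a IH; congr App; apply: functional_extensionality => i.
Qed.

Lemma bind_ground (r : void -> ground S) t : bind r t = t.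
Proof.
by elim: t => [[]|f a IH] /=; congr App; apply: functional_extensionality => i.
Qed.

Lemma bind_eq V W (r r' : V -> term S W) t :
  (forall x, vin x t -> r x = r' x) -> bind r t = bind r' t.
Proof.
elim: t => [x|f a IH] /= E; first exact: E.
congr App; apply: functional_extensionality => i; apply: IH => x xi.
by apply: E; exists i.
Qed.

Lemma attach_map V (P : pred nat) (p : pattern S) (H : forall x, occurs x p -> P x)
    (s : {x | P x} -> V) (s' : nat -> V) :
  (forall x Px, s (exist _ x Px) = s' x) -> map_term s (attach H) = map_term s' p.
Proof.
move=> E; elim: p H => [x|f a IH] H /=; first by rewrite E.
by congr App; apply: functional_extensionality => i.
Qed.

(** Replaces the substitution of a redex, defined on the variables of the left-hand side only, by
    one on all variables; [v] is the default value. *)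
Lemma total_sub V (P : pred nat) (s : {x | P x} -> V) (v : V) :
  exists s', forall x Px, s (exist _ x Px) = s' x.
Proof.
apply: (fun_choice (P := fun x y => forall Px, s (exist _ x Px) = y)) => x.
case: (classic (P x)) => [Px|nPx]; last by exists v.
by exists (s (exist _ x Px)) => Px'; rewrite (bool_irrelevance Px Px').
Qed.

(* The states are all ground terms, read modulo the congruence [P]. *)
Definition term_automaton (P : ground S -> ground S -> Prop) : automaton S :=
  Automaton (state := ground S) (fun f q c => P (App f q) c).

Lemma term_automaton_ev P V (s : V -> ground S) t c : per P -> P c c ->
  ev (A := term_automaton P) s t c -> P (bind s t) c.
Proof.
move=> perP; elim: t c => [x|f a IH] c Pc /=; first by move->.
case=> p pc ap; apply: per_trans (pc) => //; apply: per_sym => //.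
have Pp := per_refl perP pc.
apply: per_cong => // i; apply: per_sym => //; apply: IH => //.
exact: per_arg Pp.
Qed.

Lemma term_automaton_gev P t c : per P -> gev (A := term_automaton P) t c -> P t c.
Proof.
move=> perP tc; rewrite -[t](bind_ground (@of_void _)).
apply: term_automaton_ev => //.
by case: t tc => [[]|f a] [p pc _]; apply: per_refl (per_sym perP pc).
Qed.

(** The homomorphism names each state by a term, and any term that evaluates to the state is related
    by [P] to its name. Determinism of [A] is not assumed. *)
Lemma teq_sub (A : automaton S) P (h : state A -> ground S) : per P ->
  ahom (A := A) (B := term_automaton P) h -> sub_rel (teq A) P.
Proof.
move=> perP hom s t [q sq tq].
have sP := term_automaton_gev perP (gev_hom hom sq).
have tP := term_automaton_gev perP (gev_hom hom tq).
exact: per_trans sP (per_sym perP tP).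
Qed.

End Terms.

(** * One step of equality saturation *)

Section Step.
Variables (S : signature) (R : seq (rule S)) (A : automaton S).
Hypothesis eA : egraph A.

Local Notation T := (Tstep R A).
Local Notation E := (fun q q' : tstate R A => exists m u, label m u q /\ label m u q').

Definition cls (q : tstate R A) : state T :=
  exist _ (eqclass E q) (ex_intro _ q erefl).

Lemma redex_sub (m : redex R A) : exists s : nat -> state A,
  ev s (lhs (rx_rule m)) (rx_root m) /\ rx_rhs m = map_term s (rhs (rx_rule m)).
Proof.
have [s sP] := total_sub (@rx_sub _ _ _ m) (rx_root m); exists s; split; last exact: attach_map.
have /runsP := rx_runs m; rewrite /rlhs (attach_map _ sP) ev_map; exact: ev_eq.
Qed.

Lemma cls_eq q q' : E q q' -> cls q = cls q'.
Proof.
move=> qq'; apply: sig_inj => /=; apply: functional_extensionality => x.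
apply: propositional_extensionality; split; apply: rst_trans; last exact: rst_step.
exact/rst_sym/rst_step.
Qed.

Lemma cls_label m u q q' : label m u q -> label m u q' -> cls q = cls q'.
Proof. by move=> uq uq'; apply: cls_eq; exists m, u. Qed.

Lemma cls_surj (Q : state T) : exists q, Q = cls q.
Proof. by case: Q => X [q XE]; exists q; apply: sig_inj. Qed.

Lemma cls_trans f q q0 : ttrans q q0 -> trans T f (fun i => cls (q i)) (cls q0).
Proof. by move=> qq0; exists q, q0; split. Qed.

Lemma cls_old_hom : ahom (A := A) (B := T) (fun q => cls (Old R q)).
Proof. by move=> f q c qc; apply: cls_trans; apply: ttrans_old. Qed.

Lemma label_ex (m : redex R A) u : subterm u (rx_rhs m) -> exists q, label m u q.
Proof.
move=> um; case: (classic (u = rx_rhs m)) => [->|neu].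
  by exists (Old R (rx_root m)); apply: label_root.
case: u um neu => [q|f a] um neu.
  by exists (Old R q); apply: label_state.
have fu : fresh_subterm m (App f a) by [].
by exists (New (exist _ _ fu)); apply: (label_new (exist _ _ fu)).
Qed.

(** For [u = rx_rhs m] this says that the added transitions evaluate the right-hand side to the root
    of the redex. *)
Lemma label_ev (m : redex R A) u q : subterm u (rx_rhs m) -> label m u q ->
  ev (A := T) (fun x => cls (Old R x)) u (cls q).
Proof.
elim: u q => [x|f a IH] q um uq /=; first exact: cls_label (label_state um) uq.
have am i : subterm (a i) (rx_rhs m) by apply: subterm_trans um; apply: subterm_App.
have [p ap] := fun_choice (fun i => label_ex (am i)).
exists (fun i => cls (p i)) => [|i]; last exact: IH.
by apply: cls_trans; apply: ttrans_new um ap uq.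
Qed.

Lemma label_subterm (m : redex R A) (u : {u | fresh_subterm m u}) :
  subterm (sval u) (rx_rhs m).
Proof. by case: (svalP u). Qed.

Section Representatives.
Variable rep : state A -> ground S.
Hypothesis repP : forall q, gev (rep q) q.

Definition trep (q : tstate R A) : ground S :=
  match q with Old q => rep q | New m u => bind rep (sval u) end.

Lemma trepP q : gev (A := T) (trep q) (cls q).
Proof.
have oldP x : gev (A := T) (rep x) (cls (Old R x)) by apply: gev_hom cls_old_hom _.
case: q => [x|m u] /=; first exact: oldP.
apply: ev_bind (label_ev (label_subterm u) (label_new u)) => x _; exact: oldP.
Qed.

(** Naming states by [trep] gives a homomorphism into the ground terms modulo [P]. A root is named
    by a representative of the redex, which closure under the rules relates to the instance of the
    right-hand side; so identified labels have related names. *)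
Lemma Tstep_min P : per P -> closed R P -> sub_rel (teq A) P -> sub_rel (teq T) P.
Proof.
move=> perP RP AP.
have repPP q : P (rep q) (rep q) by apply: AP; exists q.
have rhsP (m : redex R A) : P (rep (rx_root m)) (bind rep (rx_rhs m)).
  have [s [sl ->]] := redex_sub m; rewrite bind_map.
  have lP : P (rep (rx_root m)) (bind (fun x => rep (s x)) (lhs (rx_rule m))).
    apply: AP; exists (rx_root m) => //.
    by apply: ev_bind sl => x _; apply: repP.
  apply: per_trans (lP) _ => //; apply: RP; first exact: rx_in.
  exact: per_refl (per_sym perP lP).
have subP (m : redex R A) u : subterm u (rx_rhs m) -> P (bind rep u) (bind rep u).
  move=> um; apply: per_subterm (subterm_bind rep um) => //.
  exact: per_refl (per_sym perP (rhsP m)).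
have labP (m : redex R A) u q : label m u q -> P (trep q) (bind rep u).
  by case=> [|x _|u'] //=; apply/subP/label_subterm.
have trepPP (q : tstate R A) : P (trep q) (trep q).
  by case: q => [q|m u] //=; apply/subP/label_subterm.
have clsP (q q' : tstate R A) : @eqclass (tstate R A) E q q' -> P (trep q) (trep q').
  elim=> [x y [m [u [/labP ux /labP uy]]]|x|x y _|x y z _ xy _] //.
  - exact: per_trans ux (per_sym perP uy).
  - exact: per_sym.
  - exact: per_trans xy.
(* [c] picks a member of each class of labels; up to [P], the name [trep] does not depend on the
   choice. *)
have [c cP] := fun_choice cls_surj.
have trepcP (Q : state T) q : sval Q = eqclass E q -> P (trep (c Q)) (trep q).
  move=> QE; apply: clsP; have -> : eqclass E (c Q) = sval Q by rewrite {2}(cP Q).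
  by rewrite QE; apply: rst_refl.
apply: (@teq_sub _ T P (fun Q => trep (c Q))) => // f Q Q0 [q [q0 [Qq Qq0 qq0]]] /=.
suff qP : P (App f (fun i => trep (q i))) (trep q0).
  have {}qP : P (App f (fun i => trep (q i))) (trep (c Q0)).
    by apply: per_trans qP _ => //; apply: per_sym => //; apply: trepcP.
  apply: per_trans (qP) => //; apply: per_sym => //; apply: per_cong => //.
    exact: per_refl qP.
  by move=> i; apply: per_sym => //; apply: trepcP.
case: qq0 {Qq Qq0} => [p p0 pp0|m a p p0 am ap a0].
  by apply: AP; exists p0; [exists p => // i | ]; apply: repP.
apply: per_trans (per_sym perP (labP _ _ _ a0)) => //; apply: per_sym => //.
apply: per_cong => //; first exact: (subP _ _ am).
by move=> i; apply: per_sym => //; apply: labP (ap i).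
Qed.

End Representatives.

Lemma Tstep_reach (Q : state T) : exists t, gev t Q.
Proof.
have [q ->] := cls_surj Q; case/egraphP: eA => _ rA.
by have [rep repP] := fun_choice rA; exists (trep rep q); apply: trepP.
Qed.

Lemma Tstep_teq : sub_rel (teq A) (teq T).
Proof.
by move=> s t [q sq tq]; exists (cls (Old R q)); apply: gev_hom cls_old_hom _.
Qed.

(** The values of the terms [s x] form the substitution of a redex. Determinism is what makes the
    left-hand side evaluate under it to the same state [c]. *)
Lemma Tstep_rule r (s : nat -> ground S) : List.In r R ->
  teq A (bind s (lhs r)) (bind s (lhs r)) -> teq T (bind s (lhs r)) (bind s (rhs r)).
Proof.
case/egraphP: eA => fA _ rR [c lc _].
have [s' s'P] : exists s' : nat -> state A, forall x, vin x (lhs r) -> gev (s x) (s' x).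
  apply: (fun_choice (P := fun x (q : state A) => vin x (lhs r) -> gev (s x) q)) => x.
  case: (classic (vin x (lhs r))) => [xl|]; last by exists c.
  by have [q xq] := ev_bind_vin lc xl; exists q.
have sl : ev s' (lhs r) c by apply: functional_ev_bind fA s'P lc.
pose s0 (x : rvar r) := s' (sval x).
have s0P x Px : s0 (exist _ x Px) = s' x by [].
have runs0 : runs (map_term s0 (rlhs r)) c.
  by apply/runsP; rewrite /rlhs (attach_map _ s0P) ev_map.
pose m := Redex rR runs0.
have mE : rx_rhs m = map_term s' (rhs r) by apply: attach_map.
exists (cls (Old R c)); first by apply: gev_hom cls_old_hom _.
have := label_ev (subterm_refl _) (label_root m); rewrite mE ev_map => sr.
apply: ev_bind sr => x /vin_occurs/rule_vars/vin_occurs xl.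
exact: gev_hom cls_old_hom (s'P x xl).
Qed.

Lemma ICO_egraph : egraph (ICO R A).
Proof. exact: (CC_P Tstep_reach).1. Qed.

Lemma ICO_teqE s t : teq (ICO R A) s t <-> cl [::] (teq T) s t.
Proof. exact: (CC_P Tstep_reach).2. Qed.

Lemma ICO_teq : sub_rel (teq A) (teq (ICO R A)).
Proof. by move=> s t /Tstep_teq st; apply/ICO_teqE/cl_base. Qed.

Lemma ICO_rule r (s : nat -> ground S) : List.In r R ->
  teq A (bind s (lhs r)) (bind s (lhs r)) ->
  teq (ICO R A) (bind s (lhs r)) (bind s (rhs r)).
Proof. by move=> rR /(Tstep_rule rR) st; apply/ICO_teqE/cl_base. Qed.

Lemma ICO_min P : per P -> closed R P -> sub_rel (teq A) P -> sub_rel (teq (ICO R A)) P.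
Proof.
move=> perP RP AP s t /ICO_teqE; apply: cl_min => //.
case/egraphP: eA => _ rA; have [rep repP] := fun_choice rA.
exact: Tstep_min repP _ _ _ _.
Qed.

End Step.

(** * Equality saturation as a least congruence *)

Section Saturation.
Variables (S : signature) (R : seq (rule S)) (G : automaton S).
Hypothesis eG : egraph G.

Local Notation A := (ICO_iter R G).
Local Notation W := (cl R (teq G)).

Lemma ICO_iterS n : A n.+1 = ICO R (A n). Proof. by []. Qed.

Lemma ICO_iter_egraph n : egraph (A n).
Proof. by elim: n => //= n; apply: ICO_egraph. Qed.

Lemma ICO_iter_teq m n : m <= n -> sub_rel (teq (A m)) (teq (A n)).
Proof.
move/subnK <-; elim: (n - m) => [|k IH] // s t /IH.
by rewrite addSn ICO_iterS; apply: ICO_teq; apply: ICO_iter_egraph.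
Qed.

Lemma ICO_iter_cl n : sub_rel (teq (A n)) W.
Proof.
elim: n => [|n IH]; first by move=> s t; apply: cl_base.
rewrite ICO_iterS; apply: ICO_min => //; first exact: ICO_iter_egraph.
  exact: cl_per.
exact: cl_closed.
Qed.

(** The union of the increasing chain is itself a closed partial congruence: each closure condition
    has finitely many premises, which hold together at some stage, and a rule costs one more
    stage. *)
Lemma cl_ICO_iter s t : W s t -> exists n, teq (A n) s t.
Proof.
have perA n : per (teq (A n)) by apply: teq_per; case/egraphP: (ICO_iter_egraph n).
move: s t; apply: (cl_min (P := fun s t => exists n, teq (A n) s t)); last first.
- by move=> s t; exists 0.
- move=> r s rR [n ln]; exists n.+1.
  by rewrite ICO_iterS; apply: ICO_rule => //; apply: ICO_iter_egraph.
- split.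
  + by move=> s t [n st]; exists n; apply: per_sym.
  + move=> s t u [m st] [n tu]; exists (maxn m n).
    apply: per_trans (ICO_iter_teq (leq_maxl m n) st) _ => //.
    exact: ICO_iter_teq (leq_maxr m n) _ _ tu.
  + by move=> f a i [n an]; exists n; apply: per_arg an.
  + move=> f a b [n an] /fun_choice[m mP]; pose k := maxn n (\max_i m i).
    exists k; apply: per_cong => //; first exact: ICO_iter_teq (leq_maxl _ _) _ _ an.
    move=> i; apply: ICO_iter_teq (mP i).
    by apply: leq_trans (leq_maxr _ _); apply: leq_bigmax.
Qed.

Lemma EqSat_P : egraph (EqSat R G) /\ forall s t, teq (EqSat R G) s t <-> W s t.
Proof.
have [eE teqE] := lub_P ICO_iter_egraph; split=> // s t; rewrite teqE; split.
  apply: cl_min => //; first exact: cl_per.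
  by move=> s' t' [n]; apply: ICO_iter_cl.
by move=> /cl_ICO_iter st; apply: cl_base.
Qed.

End Saturation.

(** * Congruences of finite index *)

Section FiniteIndex.
Variable S : signature.
Implicit Types P W : ground S -> ground S -> Prop.

(** [F] may contain terms outside the domain of [P], so a generous finite set of candidates
    suffices. *)
Definition finite_index P :=
  exists2 F : ground S -> Prop, finp F & forall t, P t t -> exists2 s, F s & P t s.

Lemma finite_states_index (A : automaton S) :
  egraph A -> finite_states A -> finite_index (teq A).
Proof.
case/egraphP=> _ rA [l lP]; have [rep repP] := fun_choice rA.
exists (fun t => exists2 q, List.In q l & t = rep q).
  exact/finp_image/finp_In.
by move=> t [q tq _]; exists (rep q); [exists q | exists q].
Qed.

Lemma subterm_inv V (u t : term S V) : subterm u t ->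
  match t with
  | Var _ => u = t
  | App f a => u = t \/ exists i, subterm u (a i)
  end.
Proof. by case=> [|f a i ua]; [case: u => *; last left | right; exists i]. Qed.

Lemma finp_subterm V (t : term S V) : finp (fun u => subterm u t).
Proof.
elim: t => [x|f a IH].
  by apply: finp_sub (finp_eq (Var x)) _ => u /subterm_inv.
apply: (finp_sub (Q := fun u => u = App f a \/ exists2 i, True & subterm u (a i))).
  apply: finp_or; first exact: finp_eq.
  by apply: finp_bigU => // ; apply: finp_finType.
by move=> u /subterm_inv[|[i ui]]; [left | right; exists i].
Qed.

Lemma finp_bind (F : ground S -> Prop) (p : pattern S) : finp F ->
  finp (fun t => exists2 s : nat -> ground S, forall x, F (s x) & t = bind s p).
Proof.
move=> finF; elim: p => [x|f a IH].
  by apply: (finp_sub finF) => t [s sF ->]; apply: sF.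
(* Different arguments may use different substitutions here: a finite superset is enough. *)
apply: (finp_sub (Q := fun t => exists2 b, forall i, exists2 s : nat -> ground S,
    forall x, F (s x) & b i = bind s (a i) & t = App f b)).
  by apply: finp_image; apply: (finp_dfun IH).
by move=> t [s sF ->]; exists (fun i => bind s (a i)) => // i; exists s.
Qed.

(** Through [trep], [F'] names every state of the flattened automaton: old states by terms of [F],
    fresh ones by subterms of right-hand sides instantiated in [F]. Congruence closure adds no class
    to these. *)
Lemma finite_index_ICO (R : seq (rule S)) (A : automaton S) :
  egraph A -> finite_index (teq A) -> finite_index (teq (ICO R A)).
Proof.
move=> eA [F finF FP]; case/egraphP: (eA) => fA rA.
have rep_ex q : exists s, F s /\ @gev S A s q.
  have [t tq] := rA q; have [s Fs [q' tq' sq']] := FP t (teq_refl tq).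
  by exists s; split=> //; rewrite (functional_ev fA tq tq').
have [rep repFP] := fun_choice rep_ex; have repP q := (repFP q).2.
pose F' t := F t \/ exists2 r, List.In r R & exists2 g,
  exists2 s : nat -> ground S, forall x, F (s x) & g = bind s (rhs r) & subterm t g.
have trepF (q : tstate R A) : F' (trep rep q).
  case: q => [q|m u] /=; first by left; apply: (repFP q).1.
  right; exists (rx_rule m); first exact: rx_in.
  have [s [_ mE]] := redex_sub m.
  exists (bind rep (rx_rhs m)); last by apply: subterm_bind; apply: label_subterm.
  exists (fun x => rep (s x)) => [x|]; first exact: (repFP _).1.
  by rewrite mE bind_map.
have perI : per (teq (ICO R A)).
  by apply: teq_per; case/egraphP: (ICO_egraph R eA).
exists F'.
  apply: finp_or => //; apply: finp_bigU => [|r _]; first exact: finp_In.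
  by apply: finp_bigU => [|g _]; [apply: finp_bind | apply: finp_subterm].
pose covered u := exists2 s, F' s & teq (ICO R A) u s.
have teqC s t : teq (Tstep R A) s t -> forall u, subterm u s -> covered u.
  case=> Q sQ _ u us; have [Qu uQ] := ev_subterm us sQ.
  have [q qE] := cls_surj Qu; rewrite qE in uQ.
  exists (trep rep q) => //; apply/ICO_teqE => //; apply: cl_base.
  by exists (cls q); last exact: trepP.
(* All subterms are included because [cl_arg] passes to arguments. *)
suff clC s t : cl [::] (teq (Tstep R A)) s t ->
    (forall u, subterm u s -> covered u) /\ (forall u, subterm u t -> covered u).
  by move=> t /(ICO_teqE R eA)/clC[tC _]; apply/tC/subterm_refl.
elim=> {s t} [s t st|s t _ [] //|s t u _ [sC _] _ [_ uC]|f a i _ [aC _]|f a b ab [aC _] abi IH|//].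
- by split; [apply: teqC st | apply: (teqC t s); case: st => Q; exists Q].
- by [].
- by split=> u ui; apply: aC; apply: subterm_arg ui.
split=> // u /subterm_inv[->|[i]]; last exact: (IH i).2.
have [s Fs as_] := aC _ (subterm_refl _); exists s => //.
apply: per_trans as_ => //; apply: per_sym => //; apply/ICO_teqE => //.
exact: cl_cong.
Qed.

(* The generators are the relations f(s_1, ..., s_n) ~ s and s ~ s' of [W] among
   representatives of its finitely many classes. *)
Lemma finite_index_gen W : per W -> finite_index W ->
  exists ps : seq (ground S * ground S),
    (forall p, List.In p ps -> W p.1 p.2) /\
    forall Q, per Q -> (forall p, List.In p ps -> Q p.1 p.2) -> sub_rel W Q.
Proof.
move=> perW [F finF FP].
pose F1 t := F t \/ exists2 f, True & exists2 g, forall i, F (g i) & t = @App S void f g.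
have [l lP] : finp (fun p => exists2 s, F1 s & exists2 t, F t & p = (s, t)).
  apply: finp_bigU => [|s _]; last exact: finp_image.
  apply: finp_or => //; apply: finp_bigU => [|f _]; first exact: finp_finType.
  by apply: finp_image; apply: (finp_dfun (P := fun _ => F)).
have [ps [_ psP _]] := In_filter (fun p => W p.1 p.2) l.
exists ps; split=> [p /psP[]//|Q perQ psQ].
have F1Q s t : F1 s -> F t -> W s t -> Q s t.
  move=> Fs Ft st; apply: (psQ (s, t)); apply/psP; split=> //.
  by apply: lP; exists s => //; exists t.
(* Induction on the term: its arguments are replaced by representatives, and then one generator
   applies at the root. *)
suff cov t : W t t -> exists s, [/\ F s, W t s & Q t s].
  move=> s t st; have [s' [Fs' ss' Qss']] := cov s (per_refl perW st).
  have [t' [Ft' tt' Qtt']] := cov t (per_refl perW (per_sym perW st)).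
  apply: per_trans Qss' _ => //; apply: per_trans (per_sym perQ Qtt') => //.
  apply: F1Q => //; first by left.
  by apply: per_trans tt' => //; apply: per_trans st => //; apply: per_sym.
elim: t => [[]|f a IH] Wa.
have [s sP] := fun_choice (fun i => IH i (per_arg perW i Wa)).
have Was : W (App f a) (App f s) by apply: per_cong => // i; case: (sP i).
have Wsa := per_sym perW Was.
have [u Fu su] := FP _ (per_refl perW Wsa).
have Qsu : Q (App f s) u.
  by apply: F1Q => //; right; exists f => //; exists s => // i; case: (sP i).
exists u; split=> //; first exact: per_trans Was su.
apply: per_trans (Qsu) => //; apply: per_sym => //; apply: per_cong => //.
  exact: per_refl Qsu.
by move=> i; apply: per_sym => //; case: (sP i).
Qed.

Lemma eqsat_terminates_index (R : seq (rule S)) (G : automaton S) :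
  egraph G -> finite_states G ->
  eqsat_terminates R G <-> finite_index (cl R (teq G)).
Proof.
move=> eG finG; pose A := ICO_iter R G.
have eA n : egraph (A n) by apply: ICO_iter_egraph.
have perA n : per (teq (A n)) by apply: teq_per; case/egraphP: (eA n).
split.
  case=> n [h _ hP].
  (* The isomorphism maps the next iterate back into [A n], which therefore satisfies the rules
     already. *)
  have WA : sub_rel (cl R (teq G)) (teq (A n)).
    apply: cl_min => //; last exact: ICO_iter_teq (leq0n n).
    move=> r s rR sl; have [q lq rq] := ICO_rule (eA n) rR sl.
    have hom : ahom (A := ICO R (A n)) (B := A n) h by move=> f p c /hP.
    by exists (h q); apply: gev_hom hom _.
  have finA k : finite_index (teq (A k)).
    elim: k => [|k IH]; first exact: finite_states_index.
    exact: finite_index_ICO.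
  have [F finF FP] := finA n; exists F => // t /WA/FP[s Fs ts]; exists s => //.
  exact: ICO_iter_cl ts.
move=> /(finite_index_gen (cl_per R _))[ps [psW psP]].
have [n nP] : exists n, forall p, List.In p ps -> teq (A n) p.1 p.2.
  elim: ps psW {psP} => [|p ps IH] psW; first by exists 0.
  have [|n nP] := IH; first by move=> p' p'ps; apply: psW; right.
  have [m mP] := cl_ICO_iter eG (psW p (or_introl erefl)).
  exists (maxn m n) => p' [<-|/nP].
    exact: ICO_iter_teq (leq_maxl m n) _ _ mP.
  exact: ICO_iter_teq (leq_maxr m n) _ _.
exists n; apply: aiso_teq; [exact: (eA n.+1) | exact: eA | |exact: (@ICO_iter_teq _ _ _ eG n n.+1)].
by move=> s t /(ICO_iter_cl eG (n := n.+1)); apply: psP.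
Qed.

End FiniteIndex.

(** * Instances as tree automata *)

Section Atoms.
Variable S : signature.

Lemma snoc_lift n X (q : 'I_n -> X) c i : snoc q c (lift ord_max i) = q i.
Proof. by rewrite /snoc liftK. Qed.

Lemma snoc_max n X (q : 'I_n -> X) c : snoc q c ord_max = c.
Proof. by rewrite /snoc unlift_none. Qed.

Lemma snocP n X (q : 'I_n -> X) c i : snoc q c i = c \/ exists j, snoc q c i = q j.
Proof. by rewrite /snoc; case: unlift => [j|]; [right; exists j | left]. Qed.

Lemma atom_ind X (P : atom (rel_schema S) X -> Prop) :
  (forall f q c, P (rel_atom (f := f) q c)) -> forall a, P a.
Proof.
move=> H [f p]; have := H f (fun i => p (lift ord_max i)) (p ord_max).
congr (P (Atom _ _)); apply: functional_extensionality => i.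
by rewrite /snoc; case: unliftP => [j|] ->.
Qed.

Lemma map_rel_atom X Y (h : X -> Y) (f : S) q c :
  map_atom h (rel_atom (f := f) q c) = rel_atom (fun i => h (q i)) (h c).
Proof.
congr Atom; apply: functional_extensionality => i /=.
by rewrite /snoc; case: unlift.
Qed.

(** The types of the arguments depend on [f] and [f'], so the equality is not injected
    componentwise; a property [K] of the three components is transported instead. *)
Lemma rel_atom_eq X (K : forall f : S, ('I_(arity f) -> X) -> X -> Prop)
    f q c f' q' c' :
  rel_atom (f := f) q c = rel_atom (f := f') q' c' -> K f' q' c' -> K f q c.
Proof.
pose K' (a : atom (rel_schema S) X) :=
  K (arel a) (fun i => aargs a (lift ord_max i)) (aargs a ord_max).
have K'E g p d : K' (rel_atom (f := g) p d) = K g p d.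
  rewrite /K' /= snoc_max; congr (K g _ d).
  by apply: functional_extensionality => i; rewrite snoc_lift.
by rewrite -!K'E => ->.
Qed.

Lemma in_rel_atom X (x : X) (f : S) q c :
  in_atom x (rel_atom (f := f) q c) <-> x = c \/ exists i, x = q i.
Proof.
split=> [[i /= <-]|[->|[i ->]]].
- by case: (snocP q c i) => [|[j]] ->; [left | right; exists j].
- by exists ord_max; apply: snoc_max.
- by exists (lift ord_max i); apply: snoc_lift.
Qed.

Lemma in_map_atom X Y (h : X -> Y) (a : atom (rel_schema S) X) y :
  in_atom y (map_atom h a) <-> exists2 x, in_atom x a & y = h x.
Proof.
split=> [[i <-]|[x [i <-] ->]]; last by exists i.
by exists (aargs a i) => //; exists i.
Qed.

End Atoms.

Section Instances.
Variables (S : signature) (C N : Type).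
Local Notation V := (value C N).
Implicit Types (I J : instance (rel_schema S) C N).

(** All values are states, so that every instance of a sequence has the same state type; values
    outside the active domain are unreachable. *)
Definition vaut I : automaton S :=
  Automaton (state := V) (fun f q c => I (rel_atom q c)).

Lemma adomP I v : adom I v -> exists f q c,
  I (rel_atom (f := f) q c) /\ (v = c \/ exists i, v = q i).
Proof. by case; elim/atom_ind => f q c [Ia /in_rel_atom va]; exists f, q, c. Qed.

Lemma adom_arg I f q c i : I (rel_atom (f := f) q c) -> adom I (q i).
Proof. by exists (rel_atom q c); split=> //; apply/in_rel_atom; right; exists i. Qed.

Lemma adom_res I f q c : I (rel_atom (f := f) q c) -> adom I c.
Proof. by exists (rel_atom q c); split=> //; apply/in_rel_atom; left. Qed.

Lemma gev_output I t v : gev (A := vaut I) t v -> exists f q, I (rel_atom (f := f) q v).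
Proof. by case: t => [[]|f a [q qv _]]; exists f, q. Qed.

Lemma maps_into_adom X (h : X -> V) b I x : maps_into h b I -> in_atoms b x -> adom I (h x).
Proof.
move=> hb [a [ab [i ax]]]; exists (map_atom h a); split; first exact: hb.
by exists i; rewrite /= ax.
Qed.

Lemma maps_into_eq X (h h' : X -> V) b I :
  (forall x, in_atoms b x -> h' x = h x) -> maps_into h b I -> maps_into h' b I.
Proof.
move=> E hb a ab; have := hb a ab; congr I; congr Atom.
by apply: functional_extensionality => i; rewrite E //; exists a; split=> //; exists i.
Qed.

(** * Homomorphisms from flattened patterns as evaluations *)

Section Flattening.
Implicit Types (w : pattern S -> dvar S) (r : dvar S) (p : pattern S) (h : dvar S -> V).

Lemma flattening_In w r f (a : 'I_(arity f) -> pattern S) x :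
  List.In x (flattening w r (App f a)) <->
  x = rel_atom (fun i => wvar w (a i)) r \/
  exists i, List.In x (flattening w (wvar w (a i)) (a i)).
Proof.
rewrite /= In_flatten; split.
  case=> [<-|[s /In_map[i _ ->] xi]]; first by left.
  by right; exists i.
case=> [->|[i xi]]; [by left | right].
exists (flattening w (wvar w (a i)) (a i)) => //.
by apply/In_map; exists i => //; apply: In_enum.
Qed.

Lemma flattening_sub w r f (a : 'I_(arity f) -> pattern S) i z :
  in_atoms (flattening w (wvar w (a i)) (a i)) z ->
  in_atoms (flattening w r (App f a)) z.
Proof. by case=> x [xi zx]; exists x; split=> //; apply/flattening_In; right; exists i. Qed.

Lemma flattening_root w r f (a : 'I_(arity f) -> pattern S) z :
  in_atom z (rel_atom (fun i => wvar w (a i)) r) ->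
  in_atoms (flattening w r (App f a)) z.
Proof. by exists (rel_atom (fun i => wvar w (a i)) r); split=> //; apply/flattening_In; left. Qed.

Lemma flattening_PVar w r f (a : 'I_(arity f) -> pattern S) x :
  occurs x (App f a) -> in_atoms (flattening w r (App f a)) (PVar x).
Proof.
suff H p r' : occurs x p -> p = Var x \/ in_atoms (flattening w r' p) (PVar x).
  by move=> /(H _ r)[].
elim: p r' => [y|g b IH] r'; first by move=> /eqP ->; left.
move=> /existsP[i /(IH i (wvar w (b i)))[bi|bi]]; right; last exact: flattening_sub bi.
by apply: flattening_root; apply/in_rel_atom; right; exists i; rewrite bi.
Qed.

Lemma flattening_vars w r p z : in_atoms (flattening w r p) z ->
  [\/ z = r, exists2 u, z = w u & forall x, occurs x u -> occurs x p
    | exists2 x, occurs x p & z = PVar x].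
Proof.
elim: p r => [x|f a IH] r; first by case=> ? [].
have ai_f i x : occurs x (a i) -> occurs x (App f a) by apply: occurs_arg.
have wvarP i : (exists2 u, wvar w (a i) = w u & forall x, occurs x u -> occurs x (App f a)) \/
    exists2 x, occurs x (App f a) & wvar w (a i) = PVar x.
  have := ai_f i; case: (a i) => [x|g b] xi; last by left; exists (App g b).
  by right; exists x => //; apply: xi; rewrite /=.
case=> x [/flattening_In[-> /in_rel_atom|[i xi] zx]].
  case=> [->|[i ->]]; first by constructor 1.
  by case: (wvarP i) => ?; [constructor 2 | constructor 3].
have [|->|[u -> ui]|[y yi ->]] := IH i (wvar w (a i)); first by exists x.
- by case: (wvarP i) => ?; [constructor 2 | constructor 3].
- by constructor 2; exists u => // y /ui/ai_f.
- by constructor 3; exists y => //; apply: ai_f yi.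
Qed.

Lemma flattening_ev I w r p h : maps_into h (flattening w r p) I ->
  (forall x, p = Var x -> r = PVar x) ->
  ev (A := vaut I) (fun x => h (PVar x)) p (h r).
Proof.
elim: p r => [x|f a IH] r hp rP; first by rewrite (rP x).
exists (fun i => h (wvar w (a i))) => [|i].
  rewrite /= -map_rel_atom; apply: hp; apply/flattening_In; by left.
apply: IH => [x xi|x ->//]; apply: hp; apply/flattening_In; by right; exists i.
Qed.

(** Equal subpatterns share a variable w_u, so [h] must give them one value; determinism makes the
    value of u a consistent choice. *)
Lemma flattening_maps_into I w r p h (s : nat -> V) :
  functional (vaut I) ->
  (forall u v, ev (A := vaut I) s u v -> h (wvar w u) = v) ->
  ev (A := vaut I) s p (h r) -> maps_into h (flattening w r p) I.
Proof.
move=> fI hP; elim: p r => [x|f a IH] r; first by move=> _ x'.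
case=> p /= pr ap x /flattening_In[->|[i]]; last first.
  by move: x; apply: IH; rewrite (hP _ _ (ap i)); apply: ap.
rewrite map_rel_atom; congr I: pr; congr rel_atom.
by apply: functional_extensionality => i; rewrite (hP _ _ (ap i)).
Qed.

Lemma rule_bodies_PVar (l : pattern S) b x : List.In b (rule_bodies l) -> occurs x l ->
  in_atoms b.1 (PVar x).
Proof.
case: l => [y|f a]; last first.
  by case=> // <- /(flattening_PVar (@LVar S) (LVar (App f a))).
move=> /In_map[f _ ->] /= /eqP ->.
exists (rel_atom (fun i : 'I_(arity f) => ArgVar i) (PVar y)); split; first by left.
by apply/in_rel_atom; left.
Qed.

Lemma rule_bodies_root (l : pattern S) b : List.In b (rule_bodies l) -> in_atoms b.1 b.2.
Proof.
case: l => [y|f a].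
  move=> /In_map[f _ ->] /=.
  exists (rel_atom (fun i : 'I_(arity f) => ArgVar i) (PVar y)); split; first by left.
  by apply/in_rel_atom; left.
by case=> // <-; apply: flattening_root; apply/in_rel_atom; left.
Qed.

Lemma rule_bodies_RVar (l : pattern S) b u : List.In b (rule_bodies l) -> ~ in_atoms b.1 (RVar u).
Proof.
case: l => [y|f a].
  by move=> /In_map[f _ ->] [a [[<-|//] /in_rel_atom[|[i]]]].
by case=> // <- /flattening_vars[|[]|[]].
Qed.

Lemma rule_bodies_ev I (l : pattern S) b h : List.In b (rule_bodies l) -> maps_into h b.1 I ->
  ev (A := vaut I) (fun x => h (PVar x)) l (h b.2).
Proof.
case: l => [y|f a]; first by move=> /In_map[f _ ->].
by case=> // <- hb; apply: flattening_ev hb _.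
Qed.

Lemma val_of_ev I (s : nat -> V) (d : pattern S -> V) : functional (vaut I) ->
  exists g, forall u, (forall v, ev (A := vaut I) s u v -> g u = v).
Proof.
move=> fI; apply: (fun_choice (P := fun u y => forall v, ev (A := vaut I) s u v -> y = v)).
move=> u; case: (classic (exists v, ev (A := vaut I) s u v)) => [[v uv]|no].
  by exists v => v'; apply: functional_ev fI uv.
by exists (d u) => v uv; case: no; exists v.
Qed.

(** If the left-hand side is a variable, the body is an atom for some symbol with that variable as
    result; the last premise says which symbol to take. *)
Lemma rule_bodies_trigger I (l : pattern S) (s : nat -> V) v : functional (vaut I) ->
  ev (A := vaut I) s l v -> (exists f q, I (rel_atom (f := f) q v)) ->
  exists2 b, List.In b (rule_bodies l) &
    exists h, [/\ maps_into h b.1 I, h b.2 = v & forall x, occurs x l -> h (PVar x) = s x].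
Proof.
move=> fI; case: l => [y|f a] lv [g [q qv]].
  exists ([:: rel_atom (f := g) (fun i => ArgVar i) (PVar y)], PVar y).
    by apply/In_map; exists g => //; apply: In_enum.
  exists (fun z => match z with
          | ArgVar k => if insub k is Some i then q i else v
          | _ => v
          end); split=> // [x [<-|//]|x /= /eqP ->]; last by rewrite lv.
  rewrite map_rel_atom; congr I: qv; congr rel_atom.
  by apply: functional_extensionality => i; rewrite valK.
have [k kP] := val_of_ev s (fun=> v) fI.
pose h z := match z with PVar x => s x | LVar u => k u | _ => v end.
exists (flattening (@LVar S) (LVar (App f a)) (App f a), LVar (App f a)); first by left.
exists h; split=> //; last exact: kP.
apply: (flattening_maps_into fI (s := s)); last by rewrite /h (kP _ _ lv); apply: lv.
by case=> [x|g' b] u //; apply: kP.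
Qed.

Lemma head_maps_into I (l : pattern S) b p h : functional (vaut I) -> List.In b (rule_bodies l) ->
  ev (A := vaut I) (fun x => h (PVar x)) p (h b.2) ->
  exists h', extends b.1 h h' /\ maps_into h' (flattening (@RVar S) b.2 p) I.
Proof.
move=> fI bl pv; have [k kP] := val_of_ev (fun x => h (PVar x)) (fun u => h (RVar u)) fI.
pose h' z := match z with RVar u => k u | _ => h z end.
have h'E z : in_atoms b.1 z -> h' z = h z.
  by case: z => // u /(rule_bodies_RVar bl).
exists h'; split=> //; apply: (flattening_maps_into fI (s := fun x => h (PVar x))).
  by case=> [x|g c] v //; apply: kP.
by rewrite h'E //; apply: rule_bodies_root bl.
Qed.

End Flattening.

Lemma in_GammaP (R : seq (rule S)) d : in_Gamma R d <->
  (exists f, d = functional_EGD f) \/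
  exists r b, [/\ List.In r R, List.In b (rule_bodies (lhs r))
                & d = rule_dependency (rhs r) b].
Proof.
rewrite /in_Gamma In_cat In_map In_flatten; split.
  case=> [[f _ ->]|[s /In_map[r rR ->] /In_map[b bl ->]]]; first by left; exists f.
  by right; exists r, b.
case=> [[f ->]|[r [b [rR bl ->]]]]; first by left; exists f => //; apply: In_enum.
right; exists [seq rule_dependency (rhs r) b | b <- rule_bodies (lhs r)].
  by apply/In_map; exists r.
by apply/In_map; exists b.
Qed.

Variable R : seq (rule S).

Lemma model_functional I :
  model (fun d => in_Gamma R d /\ is_EGD d) I -> functional (vaut I).
Proof.
move=> mI f q c c' qc qc'; apply: NNPP => ne.
pose h (z : dvar S) := match z with
  | ArgVar k => if insub k is Some i then q i else c
  | ResVar b => if b then c' else c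
  | _ => c end.
have hE : (fun i : 'I_(arity f) => h (ArgVar i)) = q.
  by apply: functional_extensionality => i; rewrite /= valK.
apply: (mI (functional_EGD f) h); first by split=> //; apply/in_GammaP; left; exists f.
by split=> // a [<-|[<-|//]]; rewrite map_rel_atom hE.
Qed.

Lemma model_sub (Gam Gam' : dependency (rel_schema S) (dvar S) -> Prop) I :
  (forall d, Gam' d -> Gam d) -> model Gam I -> model Gam' I.
Proof. by move=> sub mI d h /sub; apply: mI. Qed.

(** A substitution by terms becomes one by their values, which yields a trigger. Since it is not
    active, the right-hand side evaluates to the value of the left-hand side. *)
Lemma model_closed I : model (in_Gamma R) I -> closed R (teq (vaut I)).
Proof.
move=> mI; have fI : functional (vaut I).
  by apply: model_functional; apply: model_sub mI => d [].
move=> r s rR [v lv _].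
have [s' s'P] : exists s' : nat -> V,
    forall x, vin x (lhs r) -> gev (A := vaut I) (s x) (s' x).
  apply: (fun_choice (P := fun x q => vin x (lhs r) -> gev (A := vaut I) (s x) q)) => x.
  case: (classic (vin x (lhs r))) => [xl|]; last by exists v.
  by have [q xq] := ev_bind_vin lv xl; exists q.
have sl : ev (A := vaut I) s' (lhs r) v by apply: functional_ev_bind fI s'P lv.
have [b bl [h [hb hv hs]]] := rule_bodies_trigger fI sl (gev_output lv).
exists v => //; apply: (ev_bind (A := vaut I) (s := s')).
  by move=> x /vin_occurs/rule_vars/vin_occurs; apply: s'P.
have hsr x : vin x (rhs r) -> h (PVar x) = s' x.
  by move=> /vin_occurs/rule_vars; apply: hs.
have := mI (rule_dependency (rhs r) b) h.
case rE: (rhs r) => [x|f a] /=; last move=> nact.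
  move=> nact; apply: NNPP => ne; apply: nact.
    by apply/in_GammaP; right; exists r, b; rewrite rE.
  split=> //=; rewrite hv => hx; apply: ne.
  by rewrite -hsr // rE.
have [h' [h'E h'hd]] : exists h', extends b.1 h h' /\
    maps_into h' (flattening (@RVar S) b.2 (App f a)) I.
  apply: NNPP => no; apply: nact; last by split.
  by apply/in_GammaP; right; exists r, b; rewrite rE.
have := flattening_ev h'hd; rewrite (h'E _ (rule_bodies_root bl)) hv => aE.
have {}aE : ev (A := vaut I) (fun x => h' (PVar x)) (App f a) v by apply: aE.
apply: ev_eq aE => x xa; rewrite h'E; first by apply: hsr; rewrite rE.
by apply: rule_bodies_PVar bl _; apply: rule_vars; rewrite rE; apply/vin_occurs.
Qed.

Definition reached I := forall v, adom I v -> exists t, gev (A := vaut I) t v.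

(** Closure speaks of ground terms, so each value that a trigger gives to a variable of the
    left-hand side is first replaced by a term that reaches it. *)
Lemma closed_model I : functional (vaut I) -> reached I ->
  closed R (teq (vaut I)) -> model (in_Gamma R) I.
Proof.
move=> fI rI clI d h /in_GammaP[[f ->]|[r [b [rR bl ->]]]] [hb].
  apply; apply: (fI f (fun i => h (ArgVar i))) => /=.
    by rewrite -map_rel_atom; apply: hb; left.
  by rewrite -map_rel_atom; apply: hb; right; left.
have {}hb : maps_into h b.1 I by case: (rhs r) hb.
have lv := rule_bodies_ev bl hb.
have [s sP] : exists s : nat -> ground S,
    forall x, vin x (lhs r) -> gev (A := vaut I) (s x) (h (PVar x)).
  apply: (fun_choice (P := fun x t => vin x (lhs r) -> gev (A := vaut I) t (h (PVar x)))) => x.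
  case: (classic (vin x (lhs r))) => [xl|].
    have [|t tx] := rI (h (PVar x)); last by exists t.
    apply: maps_into_adom hb _; apply: rule_bodies_PVar bl _; exact/vin_occurs.
  have [t _] := rI _ (maps_into_adom hb (rule_bodies_root bl)).
  by exists t.
have slv : gev (A := vaut I) (bind s (lhs r)) (h b.2) by apply: ev_bind lv.
have [v lv' rv] := clI r s rR (teq_refl slv).
have {lv'} vE : v = h b.2 by apply: functional_ev fI lv' slv.
have rh : ev (A := vaut I) (fun x => h (PVar x)) (rhs r) (h b.2).
  rewrite -vE; apply: functional_ev_bind fI _ rv => x.
  by move=> /vin_occurs/rule_vars/vin_occurs; apply: sP.
case: (rhs r) rh => [x|f a] rh /=; first by apply.
by apply; apply: head_maps_into bl rh.
Qed.

End Instances.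

(** * Invariants of chase steps *)

Section Steps.
Variables (S : signature) (C N : Type) (R : seq (rule S)).
Local Notation V := (value C N).
Local Notation dep := (dependency (rel_schema S) (dvar S)).
Implicit Types (I J : instance (rel_schema S) C N) (h : dvar S -> V) (d : dep).

Lemma Gamma_EGD d : in_Gamma R d ->
  match d with EGD b x y => in_atoms b x /\ in_atoms b y | TGD _ _ => True end.
Proof.
move=> /in_GammaP[[f ->]|[r [b [rR bl ->]]]] /=.
  by split; [exists (rel_atom (f := f) (fun i => ArgVar i) (ResVar false))
            |exists (rel_atom (f := f) (fun i => ArgVar i) (ResVar true))];
    (split; last by apply/in_rel_atom; left); [left | right; left].
case E: (rhs r) => [x|f a] //=; split; last exact: rule_bodies_root bl.
by apply: rule_bodies_PVar bl _; apply: rule_vars; rewrite E /=.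
Qed.

Lemma Gamma_TGD b hd : in_Gamma R (TGD b hd) -> exists r c,
  [/\ List.In r R, List.In c (rule_bodies (lhs r)), b = c.1,
      hd = flattening (@RVar S) c.2 (rhs r) & forall x, rhs r <> Var x].
Proof.
move=> /in_GammaP[[f //]|[r [c [rR cl E]]]]; exists r, c.
by case: (rhs r) E => // f a [-> ->].
Qed.

Lemma ev_reached I (s : nat -> V) (p : pattern S) v :
  ev (A := vaut I) s p v ->
  (forall x, occurs x p -> exists t, gev (A := vaut I) t (s x)) ->
  exists t, gev (A := vaut I) t v.
Proof.
elim: p v => [x|f a IH] v /=; first by move=> <- /(_ x (eqxx x)).
case=> p pv ap sP; have tP i : exists t, gev (A := vaut I) t (p i).
  by apply: (IH i _ (ap i)) => x xi; apply: sP; apply: occurs_arg xi.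
by have [t tp] := fun_choice tP; exists (App f t), p.
Qed.

Lemma flattening_reached I w r (p : pattern S) h :
  maps_into h (flattening w r p) I ->
  (forall x, p = Var x -> r = PVar x) ->
  (forall x, occurs x p -> exists t, gev (A := vaut I) t (h (PVar x))) ->
  forall z, in_atoms (flattening w r p) z -> exists t, gev (A := vaut I) t (h z).
Proof.
elim: p r => [x|f a IH] r hp rP hx z [y []] //.
have wP i x : a i = Var x -> wvar w (a i) = PVar x by move=> ->.
have hxi i x : occurs x (a i) -> exists t, gev (A := vaut I) t (h (PVar x)).
  by move=> xi; apply: hx; apply: occurs_arg xi.
have hpi i : maps_into h (flattening w (wvar w (a i)) (a i)) I.
  by move=> y' yi; apply: hp; apply/flattening_In; right; exists i.
move=> /flattening_In[->|[i yi]] zy; last first.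
  by apply: (IH i _ (hpi i) (wP i) (hxi i)); exists y.
case/in_rel_atom: zy => [->|[i ->]].
  exact: ev_reached (flattening_ev hp rP) hx.
exact: ev_reached (flattening_ev (hpi i) (wP i)) (hxi i).
Qed.

Definition all_null I := forall v, adom I v -> exists n, v = Null n.

(** The ground terms modulo [P] as an instance, the counterpart of [term_automaton]. Its elements
    are terms and not classes, so that homomorphisms can be defined by substitution. *)
Definition term_inst (P : ground S -> ground S -> Prop)
    (a : atom (rel_schema S) (ground S)) :=
  P (App (arel a) (fun i => aargs a (lift ord_max i))) (aargs a ord_max).

Lemma term_inst_rel P f q c : term_inst P (rel_atom (f := f) q c) <-> P (App f q) c.
Proof.
rewrite /term_inst /= snoc_max.
suff -> : (fun i => snoc q c (lift ord_max i)) = q by [].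
by apply: functional_extensionality => i; rewrite snoc_lift.
Qed.

Definition term_hom P I (phi : V -> ground S) :=
  forall a, I a -> term_inst P (map_atom phi a).

Lemma term_hom_ahom P I phi : term_hom P I phi ->
  ahom (A := vaut I) (B := term_automaton P) phi.
Proof. by move=> hom f q c /hom; rewrite map_rel_atom term_inst_rel. Qed.

Lemma term_inst_eq P X (g g' : X -> ground S) (a : atom (rel_schema S) X) : per P ->
  (forall x, in_atom x a -> P (g x) (g' x)) ->
  term_inst P (map_atom g a) -> term_inst P (map_atom g' a).
Proof.
move=> perP; elim/atom_ind: a => f q c E; rewrite !map_rel_atom !term_inst_rel => Pg.
have Egg : P (App f (fun i => g (q i))) (App f (fun i => g' (q i))).
  apply: per_cong => // [|i]; first exact: per_refl Pg.
  by apply: E; apply/in_rel_atom; right; exists i.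
apply: per_trans (per_sym perP Egg) _ => //; apply: per_trans Pg _ => //.
by apply: E; apply/in_rel_atom; left.
Qed.

Lemma term_hom_dom P I phi v : per P -> term_hom P I phi -> adom I v -> P (phi v) (phi v).
Proof.
move=> perP hom [a [/hom aP va]]; elim/atom_ind: a va aP => f q c /in_rel_atom va.
rewrite map_rel_atom term_inst_rel => aP; case: va => [->|[i ->]].
  exact: per_refl (per_sym perP aP).
exact: (per_arg perP i (per_refl perP aP)).
Qed.

Lemma term_hom_teq P I phi : per P -> term_hom P I phi -> sub_rel (teq (vaut I)) P.
Proof. by move=> perP /term_hom_ahom; apply: teq_sub. Qed.

Section Congruence.
Variable P : ground S -> ground S -> Prop.
Hypotheses (perP : per P) (RP : closed R P).

Lemma body_hom I phi (l : pattern S) b h : term_hom P I phi ->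
  List.In b (rule_bodies l) -> maps_into h b.1 I ->
  P (bind (fun x => phi (h (PVar x))) l) (phi (h b.2)).
Proof.
move=> hom bl hb; apply: term_automaton_ev => //.
  apply: term_hom_dom hom _ => //; apply: maps_into_adom hb _.
  exact: rule_bodies_root bl.
exact: ev_hom (term_hom_ahom hom) (rule_bodies_ev bl hb).
Qed.

Lemma rule_hom I phi r b h : term_hom P I phi -> List.In r R ->
  List.In b (rule_bodies (lhs r)) -> maps_into h b.1 I ->
  P (phi (h b.2)) (bind (fun x => phi (h (PVar x))) (rhs r)).
Proof.
move=> hom rR bl hb; have lP := body_hom hom bl hb.
apply: per_trans (per_sym perP lP) _ => //; apply: RP => //.
exact: per_refl lP.
Qed.

(** The reason why merging is harmless: modulo [P], the two elements have the same image already. *)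
Lemma EGD_hom I phi b x y h : term_hom P I phi -> in_Gamma R (EGD b x y) ->
  maps_into h b I -> P (phi (h x)) (phi (h y)).
Proof.
move=> hom /in_GammaP[[f [-> -> ->]]|[r [c [rR cl]]]].
  move=> hb; have := hom _ (hb _ (or_introl erefl)).
  have := hom _ (hb _ (or_intror (or_introl erefl))).
  rewrite !map_rel_atom !term_inst_rel => P2 P1.
  exact: per_trans (per_sym perP P1) P2.
case E: (rhs r) => [z|//] [-> -> ->] hb.
by apply: per_sym => //; have := rule_hom hom rR cl hb; rewrite E.
Qed.

(** The root is a variable of the body whose image is fixed beforehand, so it matches the instance
    of the pattern only modulo [P]; inner variables are sent exactly to instances of their
    subpatterns. *)
Lemma flattening_hom w r (p : pattern S) (psi : dvar S -> ground S) :
  P (psi r) (bind (fun x => psi (PVar x)) p) ->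
  (forall u, in_atoms (flattening w r p) (w u) ->
    psi (w u) = bind (fun x => psi (PVar x)) u) ->
  forall a, List.In a (flattening w r p) -> term_inst P (map_atom psi a).
Proof.
set s := fun x => psi (PVar x).
elim: p r => [x|f a IH] r rP wP y //.
have aP i : psi (wvar w (a i)) = bind s (a i).
  case E: (a i) => [x|g b] //=; apply: wP; apply: flattening_root.
  by apply/in_rel_atom; right; exists i; rewrite E.
have PfP := per_sym perP rP.
move=> /flattening_In[->|[i yi]].
  rewrite map_rel_atom term_inst_rel; move: PfP => /=; congr (P (App f _) _).
  by apply: functional_extensionality => i; rewrite aP.
apply: IH yi => [|u ui].
  by rewrite aP; apply: per_arg (f) (fun i => bind s (a i)) i (per_refl perP PfP).
by apply: wP; apply: flattening_sub ui.
Qed.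

End Congruence.

Section Step.
Variables (used : V -> Prop) (d : dep) (h : dvar S -> V) (ren : V -> V).
Variables (I J : instance (rel_schema S) C N).
Hypotheses (dG : in_Gamma R d) (used_adom : forall v, adom I v -> used v).
Hypothesis step : chase_step used d h ren I J.

Lemma step_hom : ahom (A := vaut I) (B := vaut J) ren.
Proof.
move=> f q c /= qc; case: d step => [b hd|b x y] [_].
  case=> renE [h' [_ _ _ JE]]; apply/JE; left.
  rewrite renE; congr I: qc; congr rel_atom.
  by apply: functional_extensionality => i; rewrite renE.
case=> n [v [_ _ _ JE]]; apply/JE; exists (rel_atom q c); split=> //.
by rewrite map_rel_atom.
Qed.

(* An EGD step removes the null that it replaces. *)
Lemma step_fixed v : adom I v -> adom J v -> ren v = v.
Proof.
case: d step => [b hd|b x y] [act]; first by case=> ->.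
case=> n [w [hxy renn rene JE]] _ [a [/JE[a0 [_ ->]] /in_map_atom[u _ ->]]].
case: (classic (u = Null n)) => [->|une]; last by rewrite !(rene u).
rewrite renn; apply: rene => wn; case: act => _; apply.
by case: hxy => -[-> ->]; rewrite wn.
Qed.

Lemma step_reached : reached I -> reached J.
Proof.
move=> rI v; have mono : ahom (A := vaut I) (B := vaut J) ren := step_hom.
have reach_ren u : adom I u -> exists t, gev (A := vaut J) t (ren u).
  by case/rI => t tu; exists t; apply: gev_hom mono tu.
case: d dG step => [b hd|b x y] dG' [[hb _]].
  have [r [c [rR cl bE hdE rP]]] := Gamma_TGD dG'.
  case=> renE [h' [h'E _ _ JE]] [a [/JE[Ia|[a0 [a0hd ->]]] va]].
    by rewrite -(renE v); apply: reach_ren; exists a.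
  case/in_map_atom: va => z za ->; rewrite hdE in a0hd.
  apply: (flattening_reached (w := @RVar S) (r := c.2) (p := rhs r)).
  - by move=> a' a'hd; apply/JE; right; exists a'; rewrite hdE.
  - by move=> x /rP.
  - move=> x xr; have xb : in_atoms b (PVar x).
      by rewrite bE; apply: rule_bodies_PVar cl _; apply: rule_vars.
    by rewrite h'E // -(renE (h _)); apply: reach_ren; apply: maps_into_adom hb xb.
  - by exists a0.
case=> n [w [_ _ _ JE]] [a [/JE[a0 [Ia0 ->]] /in_map_atom[u ua ->]]].
by apply: reach_ren; exists a0.
Qed.

Lemma step_null : all_null I -> all_null J.
Proof.
move=> nI v; case: d dG step => [b hd|b x y] dG' [[hb _]].
  case=> renE [h' [h'E fresh _ JE]] [a [/JE[Ia|[a0 [a0hd ->]]] va]].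
    by apply: nI; exists a.
  case/in_map_atom: va => z za ->.
  have zhd : in_atoms hd z by exists a0.
  case: (classic (in_atoms b z)) => [zb|zb].
    by rewrite h'E //; apply: nI; apply: maps_into_adom hb zb.
  by have [n [-> _]] := fresh z zhd zb; exists n.
have [xb yb] := Gamma_EGD dG'.
case=> n [w [hxy renn rene JE]] [a [/JE[a0 [Ia0 ->]] /in_map_atom[u ua ->]]].
have un : adom I u by exists a0.
case: (classic (u = Null n)) => [->|une]; last by rewrite rene //; apply: nI.
rewrite renn; case: hxy => -[_ <-]; apply: nI; exact: maps_into_adom hb _.
Qed.

Lemma step_finite : finp (adom I) -> finp (adom J).
Proof.
move=> fI; case: d dG step => [b hd|b x y] dG' [[hb _]].
  case=> renE [h' [h'E fresh _ JE]].
  apply: (finp_sub (Q := fun v => adom I v \/ exists2 a0, List.In a0 hd &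
     exists2 i, True & v = h' (aargs a0 i))).
    apply: finp_or => //; apply: finp_bigU => [|a _]; first exact: finp_In.
    by apply: finp_image; apply: finp_finType.
  move=> v [a [/JE[Ia|[a0 [a0hd ->]]] va]]; first by left; exists a.
  by right; exists a0 => //; case: va => i <-; exists i.
case=> n [w [_ _ _ JE]].
apply: (finp_sub (Q := fun v => exists2 u, adom I u & v = ren u)); first exact: finp_image.
move=> v [a [/JE[a0 [Ia0 ->]] /in_map_atom[u ua ->]]].
by exists u => //; exists a0.
Qed.

(** An EGD step keeps [phi], by [EGD_hom]. A TGD step extends it by sending the fresh null for w_u
    to the instance of u. *)
Lemma step_term_hom P : per P -> closed R P ->
  (exists phi, term_hom P I phi) -> exists phi, term_hom P J phi.
Proof.
move=> perP RP [phi hom]; case: d dG step => [b hd|b x y] dG' [[hb _]]; last first.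
  case=> n [w [hxy renn rene JE]]; exists phi => a /JE[a0 [Ia0 ->]].
  apply: (term_inst_eq (g := phi) (g' := fun v => phi (ren v))) (hom _ Ia0) => // u ua.
  have uu : P (phi u) (phi u) by apply: term_hom_dom hom _ => //; exists a0.
  case: (classic (u = Null n)) => [un|une]; last by rewrite (rene u).
  have hP := EGD_hom perP RP hom dG' hb; rewrite un renn.
  case: hxy hP => -[-> ->] // hP; exact: per_sym.
have [r [c [rR cl bE hdE rP]]] := Gamma_TGD dG'.
case=> renE [h' [h'E fresh inj JE]].
pose s x := phi (h (PVar x)).
have notb u : ~ in_atoms b (RVar u) by rewrite bE; apply: rule_bodies_RVar cl.
(* Fresh nulls lie outside the active domain, so the clauses do not clash; distinct existential
   variables get distinct nulls, so the first clause is unambiguous. *)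
have [phi' phi'P] : exists phi' : V -> ground S, forall v,
    (forall u, in_atoms hd (RVar u) -> v = h' (RVar u) -> phi' v = bind s u) /\
    (adom I v -> phi' v = phi v).
  apply: (fun_choice (P := fun v y =>
    (forall u, in_atoms hd (RVar u) -> v = h' (RVar u) -> y = bind s u) /\
    (adom I v -> y = phi v))) => v.
  case: (classic (exists2 u, in_atoms hd (RVar u) & v = h' (RVar u))) => [[u uhd vE]|no].
    exists (bind s u); split=> [u' u'hd vE'|vI].
      by have [->] : RVar u = RVar u' by apply: inj; rewrite -?vE.
    have [n [uE nu]] := fresh _ uhd (notb u).
    by case: nu; rewrite -uE -vE; apply: used_adom.
  by exists (phi v); split=> // u uhd vE; case: no; exists u.
exists phi' => a /JE[Ia|[a0 [a0hd ->]]].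
  apply: (term_inst_eq (g := phi)) (hom _ Ia) => // u ua.
  have uI : adom I u by exists a.
  by rewrite ((phi'P u).2 uI); apply: term_hom_dom hom uI.
have adomb z : in_atoms b z -> phi' (h' z) = phi (h z).
  by move=> zb; rewrite h'E //; apply: (phi'P _).2; apply: maps_into_adom hb zb.
have psiE p : (forall x, occurs x p -> occurs x (lhs r)) ->
    bind (fun x => phi' (h' (PVar x))) p = bind s p.
  move=> pl; apply: bind_eq => x /vin_occurs/pl xl; apply: adomb.
  by rewrite bE; apply: rule_bodies_PVar cl xl.
rewrite hdE in a0hd.
have -> : map_atom phi' (map_atom h' a0) = map_atom (fun z => phi' (h' z)) a0 by [].
have subP u : in_atoms (flattening (@RVar S) c.2 (rhs r)) (RVar u) ->
    forall x, occurs x u -> occurs x (lhs r).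
  case/flattening_vars=> [uc|[u' [->] u'r x /u'r]|[] //]; last exact: rule_vars.
  by case: (rule_bodies_RVar (u := u) cl); rewrite uc; apply: rule_bodies_root cl.
apply: (flattening_hom perP (w := @RVar S) (r := c.2) (p := rhs r)) a0hd => [|u uhd].
  rewrite adomb ?bE; last exact: rule_bodies_root cl.
  rewrite psiE; last exact: rule_vars.
  by rewrite bE in hb; apply: rule_hom hom rR cl hb.
rewrite psiE; last exact: subP uhd.
by apply: (phi'P _).1; rewrite ?hdE.
Qed.

End Step.

End Steps.

(** * The result of a chase sequence *)

Section Eventually.
Variables (T : schema) (X C N : Type) (s : sequence T X C N).

(** For a sequence that ends at n this amounts to [P n], so finite and infinite sequences are
    treated alike. *)
Definition eventually (P : nat -> Prop) :=
  exists2 k, in_seq s k & forall j, k <= j -> in_seq s j -> P j.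

Lemma in_seq_le i j : i <= j -> in_seq s j -> in_seq s i.
Proof. by rewrite /in_seq; case: ch_len => // n; apply: leq_trans. Qed.

Lemma in_seq0 : in_seq s 0.
Proof. by rewrite /in_seq; case: ch_len. Qed.

Lemma eventuallyT (P : nat -> Prop) : (forall j, in_seq s j -> P j) -> eventually P.
Proof. by move=> H; exists 0; [apply: in_seq0 | move=> j _; apply: H]. Qed.

Lemma eventually_mono (P Q : nat -> Prop) :
  (forall j, in_seq s j -> P j -> Q j) -> eventually P -> eventually Q.
Proof. by move=> PQ [k ks kP]; exists k => // j kj js; apply/PQ/kP. Qed.

Lemma eventually_and (P Q : nat -> Prop) :
  eventually P -> eventually Q -> eventually (fun j => P j /\ Q j).
Proof.
case=> k ks kP [l ls lQ]; exists (maxn k l); first by case: leqP.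
by move=> j; rewrite geq_max => /andP[kj lj] js; split; [apply: kP | apply: lQ].
Qed.

Lemma eventually_In A (l : seq A) (P : A -> nat -> Prop) :
  (forall a, List.In a l -> eventually (P a)) ->
  eventually (fun j => forall a, List.In a l -> P a j).
Proof.
elim: l => [|a l IH] H; first exact: eventuallyT.
have evl : eventually (fun j => forall b, List.In b l -> P b j).
  by apply: IH => b bl; apply: H; right.
apply: eventually_mono (eventually_and (H a (or_introl erefl)) evl).
by move=> j _ [Pa Pl] b [<-|/Pl].
Qed.

Lemma eventually_ord n (P : 'I_n -> nat -> Prop) :
  (forall i, eventually (P i)) -> eventually (fun j => forall i, P i j).
Proof.
move=> H; apply: eventually_mono (eventually_In (l := enum 'I_n) (fun i _ => H i)).
by move=> j _ Pj i; apply: Pj; apply: In_enum.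
Qed.

Lemma eventually_ex (P : nat -> Prop) : eventually P -> exists2 j, in_seq s j & P j.
Proof. by case=> k ks kP; exists k => //; apply: kP. Qed.

End Eventually.

(** * The limit of the instances *)

Section Limit.
Variables (S : signature) (C N : Type) (R : seq (rule S)).
Local Notation V := (value C N).
Variable I0 : instance (rel_schema S) C N.
Variable s : sequence (rel_schema S) (dvar S) C N.
Hypothesis chase : chase_sequence (in_Gamma R) I0 s.
Hypotheses (I0_reached : reached I0) (I0_null : all_null I0).

Local Notation I := (ch_inst s).
Local Notation result := (result s).

Lemma ch_inst0 : I 0 = I0.
Proof.
apply: functional_extensionality => a; apply: propositional_extensionality.
by case: chase.
Qed.

Lemma ch_step i : in_seq s i.+1 -> in_Gamma R (ch_dep s i) /\
  chase_step (used_upto s i) (ch_dep s i) (ch_trig s i) (ch_ren s i) (I i) (I i.+1).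
Proof. by case: chase => _ + _ _; apply. Qed.

Lemma used_adom i v : adom (I i) v -> used_upto s i v.
Proof. by exists i. Qed.

Lemma ch_ind (Q : instance (rel_schema S) C N -> Prop) : Q I0 ->
  (forall i, in_seq s i.+1 -> Q (I i) -> Q (I i.+1)) ->
  forall i, in_seq s i -> Q (I i).
Proof.
move=> Q0 QS; elim=> [|i IH] is_; first by rewrite ch_inst0.
by apply: QS => //; apply: IH; apply: in_seq_le is_.
Qed.

Lemma ch_reached i : in_seq s i -> reached (I i).
Proof.
apply: ch_ind => // {}i /ch_step[dG st]; apply: (step_reached dG) st.
Qed.

Lemma ch_null i : in_seq s i -> all_null (I i).
Proof. by apply: ch_ind => // {}i /ch_step[dG st]; apply: (step_null dG) st. Qed.

Lemma ch_finite : finp (adom I0) -> forall i, in_seq s i -> finp (adom (I i)).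
Proof.
move=> fI0; apply: (ch_ind (Q := fun J => finp (adom J))) => // i /ch_step[dG st].
exact: step_finite dG st.
Qed.

Lemma ch_term_hom P : per P -> closed R P -> (exists phi, term_hom P I0 phi) ->
  forall i, in_seq s i -> exists phi, term_hom P (I i) phi.
Proof.
move=> perP RP hI0.
apply: (ch_ind (Q := fun J => exists phi, term_hom P J phi)) => // i /ch_step[dG st].
exact: (step_term_hom dG (@used_adom i) st).
Qed.

Fixpoint track i (v : V) k : V :=
  if k is k'.+1 then ch_ren s (i + k') (track i v k') else v.

Lemma track_hom i k : in_seq s (i + k) ->
  ahom (A := vaut (I i)) (B := vaut (I (i + k))) (fun v => track i v k).
Proof.
elim: k => [|k IH] ks f q c /=; first by rewrite addn0.
move: ks; rewrite addnS => ks qc; have [dG st] := ch_step ks.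
by have /(step_hom st) := IH (in_seq_le (leqnSn _) ks) _ _ _ qc.
Qed.

Lemma track_fixed i k v : in_seq s (i + k) ->
  (forall j, i <= j -> in_seq s j -> adom (I j) v) -> track i v k = v.
Proof.
elim: k => [|k IH] //=; rewrite addnS => ks va.
have ks' := in_seq_le (leqnSn _) ks.
have [dG st] := ch_step ks; rewrite IH //.
apply: (step_fixed st); apply: va => //; first exact: leq_addr.
by rewrite -addnS leq_addr.
Qed.

Lemma track_settles i v : in_seq s i -> adom (I i) v ->
  exists y, eventually s (fun j => i <= j /\ track i v (j - i) = y).
Proof.
move=> is_ va; case: chase => _ _ _ /(_ i (fun j => track i v (j - i)) is_).
rewrite subnn => /(_ va)[j ij _|k [ik ks kE]].
  by rewrite subSn //= subnKC.
exists (track i v (k - i)); exists k => // j kj js.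
by split; [apply: leq_trans kj | apply: kE].
Qed.

(** [L] sends an element to its final name, which exists because the sequence settles. An atom has
    finitely many arguments, so from some stage on its image carries final names only and lies in
    the result. An element that stays is never renamed, since an EGD step removes what it
    renames. *)
Lemma limit_hom i : in_seq s i -> exists L : V -> V,
  ahom (A := vaut (I i)) (B := vaut result) L /\
  forall v, adom result v -> (forall j, i <= j -> in_seq s j -> adom (I j) v) -> L v = v.
Proof.
move=> is_; have [L LP] : exists L : V -> V, forall v, adom (I i) v ->
    eventually s (fun j => i <= j /\ track i v (j - i) = L v).
  apply: (fun_choice (P := fun v y => adom (I i) v ->
    eventually s (fun j => i <= j /\ track i v (j - i) = y))) => v.
  case: (classic (adom (I i) v)) => [va|]; last by exists v.
  by have [y yP] := track_settles is_ va; exists y.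
exists L; split=> [f q c /= qc|v _ va].
  have qP := eventually_ord (fun k => LP _ (adom_arg k qc)).
  apply: eventually_mono (eventually_and qP (LP _ (adom_res qc))) => j js [jq [ij jc]].
  have := track_hom (i := i) (k := j - i); rewrite subnKC // => /(_ js _ _ _ qc) /=.
  rewrite jc; congr I; congr rel_atom.
  by apply: functional_extensionality => k; case: (jq k).
have [j js [ij <-]] := eventually_ex (LP v (va i (leqnn i) is_)).
by apply: track_fixed; rewrite ?subnKC.
Qed.

Lemma result_adom v : adom result v -> eventually s (fun j => adom (I j) v).
Proof. by case=> a [Ia va]; apply: eventually_mono Ia => j _ Ia; exists a. Qed.

Lemma result_hom0 : exists L : V -> V, ahom (A := vaut I0) (B := vaut result) L.
Proof. by have [L [LP _]] := limit_hom (in_seq0 s); exists L; rewrite -ch_inst0. Qed.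

Lemma result_reached : reached result.
Proof.
move=> v vr; have [k ks kP] := result_adom vr.
have [L [Lhom Lfix]] := limit_hom ks.
have [t tv] := ch_reached ks (kP k (leqnn k) ks).
by exists t; rewrite -[v]Lfix //; apply: gev_hom tv.
Qed.

Lemma result_null : all_null result.
Proof. by move=> v /result_adom/eventually_ex[j js]; apply: ch_null. Qed.

(** Bodies are finite, so a trigger in the result is one in all late instances, and by fairness it
    is not active in some of them. For a TGD, the witnesses found there are carried to the result by
    the limit map, which fixes the values on the body. *)
Lemma result_model : model (in_Gamma R) result.
Proof.
move=> d h dG [hb act].
have trig : eventually s (fun j => trigger d h (I j)).
  by apply: (eventually_In (P := fun a j => I j (map_atom h a))) => a /hb.
have [k ks kP] := trig; have [j [kj js nact]] : exists j,
    [/\ k <= j, in_seq s j & ~ active d h (I j)].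
  case: (classic (active d h (I k))) => [actk|]; last by exists k.
  by case: chase => _ _ /(_ k d h ks dG actk).
have jP l : j <= l -> in_seq s l -> trigger d h (I l).
  by move=> jl; apply: kP; apply: leq_trans jl.
case: d dG hb act {trig kP} nact jP => [b hd|b x y] dG /= hb act nact jP; last first.
  by apply: nact; split=> //; apply: jP.
have [L [Lhom Lfix]] := limit_hom js.
have [h' [h'E h'hd]] : exists h', extends b h h' /\ maps_into h' hd (I j).
  by apply: NNPP => no; apply: nact; split=> //; apply: jP.
apply: act; exists (fun z => L (h' z)); split=> [x xb|a /h'hd].
  rewrite h'E //; apply: Lfix; first exact: maps_into_adom hb xb.
  by move=> l jl ls; apply: maps_into_adom (jP l jl ls) xb.
elim/atom_ind: a => f q c; rewrite !map_rel_atom => qc; exact: Lhom qc.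
Qed.

(** A run uses finitely many atoms of the result, all present from some stage on. *)
Lemma gev_eventually t v : gev (A := vaut result) t v ->
  eventually s (fun j => gev (A := vaut (I j)) t v).
Proof.
elim: t v => [[]|f a IH] v /= [p pv ap].
have apE := eventually_ord (fun i => IH i _ (ap i)).
by apply: eventually_mono (eventually_and pv apE) => j js [pv' ap']; exists p.
Qed.

Lemma result_teq_sub P : per P -> closed R P -> (exists phi, term_hom P I0 phi) ->
  sub_rel (teq (vaut result)) P.
Proof.
move=> perP RP hI0 t u [v /gev_eventually tv /gev_eventually uv].
have [j js [tj uj]] := eventually_ex (eventually_and tv uv).
have [phi hom] := ch_term_hom perP RP hI0 js.
by apply: (term_hom_teq perP hom); exists v.
Qed.

End Limit.

(** * Existence of an EGD-fair chase sequence *)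

Section Existence.
Variables (S : signature) (C Q : Type) (R : seq (rule S)).
Local Notation V := (value C (Q + nat)).
Local Notation dep := (dependency (rel_schema S) (dvar S)).
Local Notation Gam := (in_Gamma R).
Local Notation inst := (instance (rel_schema S) C (Q + nat)).
Implicit Types (I J : inst) (d : dep) (h : dvar S -> V).

Variable rank : V -> nat.
Hypothesis rank_inj : forall m n : Q + nat, rank (Null m) = rank (Null n) -> m = n.

Definition EGD_model I := model (fun d => Gam d /\ is_EGD d) I.

(** Only the nulls [inr n] are created by the chase; along the sequence this property covers all
    elements used so far, so offsets from the bound are fresh. *)
Definition below_bound (k : nat) (v : V) := forall n, v = Null (inr n) -> n < k.

(* [todo] holds the TGD triggers found at the start of the current round that
   are still active.  TGD moves shorten [todo], and once it is empty EGD moves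
   shorten [cover]; so each round ends, in a model of the EGDs, and a new round
   starts with all active triggers.  This makes the sequence fair and EGD-fair.
   EGD moves decrease the rank of the null that is replaced, so that it settles. *)
Record config := Config {
  inst_of : inst;
  bound : nat;
  cover : seq V;
  todo : seq (dep * (dvar S -> V)) }.

Definition active_TGD I (x : dep * (dvar S -> V)) :=
  [/\ Gam x.1, ~ is_EGD x.1 & active x.1 x.2 I].

Record ok (c : config) : Prop := Ok {
  ok_cover : forall v, adom (inst_of c) v -> List.In v (cover c);
  ok_bound : forall v, adom (inst_of c) v -> below_bound (bound c) v;
  ok_null : all_null (inst_of c);
  ok_todo : forall x, List.In x (todo c) -> active_TGD (inst_of c) x }.

Record move := Move {
  mv_dep : dep;
  mv_trig : dvar S -> V;
  mv_ren : V -> V;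
  mv_next : config }.

Definition same_trigger d h h' := forall z, in_atoms (body_of d) z -> h' z = h z.

(** The last three clauses describe the phases of a round. In [gm_refill] a trigger is recorded up
    to its values on the body, since total maps on variables cannot be listed. *)
Record good_move (c : config) (m : move) : Prop := GoodMove {
  gm_Gamma : Gam (mv_dep m);
  gm_step : chase_step (below_bound (bound c)) (mv_dep m) (mv_trig m) (mv_ren m)
    (inst_of c) (inst_of (mv_next m));
  gm_ok : ok (mv_next m);
  gm_bound : bound c <= bound (mv_next m);
  gm_rank : forall v, mv_ren m v = v \/ rank (mv_ren m v) < rank v;
  gm_todo : todo c <> [::] -> size (todo (mv_next m)) < size (todo c) /\
    forall x, List.In x (todo c) -> active x.1 x.2 (inst_of (mv_next m)) ->
      List.In x (todo (mv_next m));
  gm_EGD : todo c = [::] -> ~ EGD_model (inst_of c) ->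
    todo (mv_next m) = [::] /\ size (cover (mv_next m)) < size (cover c);
  gm_refill : todo c = [::] -> EGD_model (inst_of c) ->
    forall d h, Gam d -> ~ is_EGD d -> active d h (inst_of c) ->
      active d h (inst_of (mv_next m)) ->
      exists2 h', same_trigger d h h' & List.In (d, h') (todo (mv_next m)) }.

Lemma active_same I d h h' : ~ is_EGD d -> same_trigger d h h' ->
  active d h I -> active d h' I.
Proof.
case: d => [b hd|b x y] dE hh' [hb act]; last by case: dE.
split; first exact: maps_into_eq hh' hb.
case=> g [gE ghd]; apply: act; exists g; split=> // z zb.
by rewrite gE // hh'.
Qed.

Lemma chase_step_used (used used' : V -> Prop) d h ren I J :
  (forall v, used' v -> used v) -> chase_step used d h ren I J ->
  chase_step used' d h ren I J.
Proof.
move=> sub [act]; case: d act => [b hd|b x y] act st; split=> //.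
case: st => renE [h' [hE fresh inj JE]]; split=> //; exists h'; split=> // z zhd zb.
by have [n [nz nu]] := fresh z zhd zb; exists n; split=> // /sub.
Qed.

Lemma apply_TGD c d h : ok c -> active_TGD (inst_of c) (d, h) ->
  exists J k l, [/\ chase_step (below_bound (bound c)) d h id (inst_of c) J,
    bound c <= k, forall t, (forall x, List.In x t -> active_TGD J x) -> ok (Config J k l t)
    & ~ active d h J].
Proof.
move=> okc [/= dG]; case: d dG => [b hd|b x y] dG dE act; last by case: dE.
have [hb _] := act.
have [zs zsP] : finp (in_atoms hd).
  apply: (finp_sub (Q := fun z => exists2 a, List.In a hd & exists2 i, True & z = aargs a i)).
    apply: finp_bigU => [|a _]; first exact: finp_In.
    by apply: finp_image; apply: finp_finType.
  by move=> z [a [ahd [i <-]]]; exists a => //; exists i.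
have [m [idx [lt_m inj]]] := numbering zs.
pose h' z := if excluded_middle_informative (in_atoms b z) then h z
             else Null (inr (bound c + idx z)).
have h'b : extends b h h'.
  by move=> z zb; rewrite /h'; case: excluded_middle_informative.
have h'n z : ~ in_atoms b z -> h' z = Null (inr (bound c + idx z)).
  by move=> zb; rewrite /h'; case: excluded_middle_informative.
pose J a := inst_of c a \/ exists a0, List.In a0 hd /\ a = map_atom h' a0.
have step : chase_step (below_bound (bound c)) (TGD b hd) h id (inst_of c) J.
  split=> //; split=> //; exists h'; split=> // [z zhd zb|z z' zhd zb zhd' zb'].
    exists (inr (bound c + idx z)); split; first exact: h'n.
    by move=> /(_ _ erefl); rewrite ltnNge leq_addr.
  rewrite !h'n // => -[/addnI]; apply: inj; exact: zsP.
have [l lP] : finp (adom J).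
  apply: (step_finite dG step); exists (cover c); exact: ok_cover.
exists J, (bound c + m), l; split=> //; first exact: leq_addr.
  move=> t tP; split=> //=; last exact: step_null dG step (ok_null okc).
  move=> v [a [[Ia|[a0 [a0hd ->]]] va]].
    move=> n vn; apply: leq_trans (leq_addr _ _).
    by apply: (ok_bound okc) vn; exists a.
  case/in_map_atom: va => z za -> n.
  have zhd : in_atoms hd z by exists a0.
  case: (classic (in_atoms b z)) => zb.
    rewrite h'b // => hz; apply: leq_trans (leq_addr _ _).
    by apply: (ok_bound okc) hz; apply: maps_into_adom hb zb.
  by rewrite h'n // => -[<-]; rewrite ltn_add2l; apply/lt_m/zsP.
by case=> _; apply; exists h'; split=> // a ahd; right; exists a.
Qed.

Lemma EGD_move c : ok c -> todo c = [::] -> ~ EGD_model (inst_of c) ->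
  exists m, good_move c m.
Proof.
move=> okc c0 nE; have [d [h [dG dE act]]] : exists d h,
    [/\ Gam d, is_EGD d & active d h (inst_of c)].
  apply: NNPP => no; apply: nE => d h [dG dE] act; apply: no; by exists d, h.
case: d dG dE act => // b x y dG _ act.
have [hb hxy] := act; have [xb yb] := Gamma_EGD dG.
have [nx hx] := ok_null okc (maps_into_adom hb xb).
have [ny hy] := ok_null okc (maps_into_adom hb yb).
(* The null of larger rank is replaced; distinct nulls never have the same rank. *)
have [n [v [nv vn vI nI]]] : exists n v,
    [/\ (h x = Null n /\ h y = v) \/ (h y = Null n /\ h x = v),
        rank v < rank (Null n), adom (inst_of c) v & adom (inst_of c) (Null n)].
  have Ix := maps_into_adom hb xb; have Iy := maps_into_adom hb yb.
  case: (ltngtP (rank (h x)) (rank (h y))) => rk.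
  - by exists ny, (h x); rewrite -hy; split=> //; right.
  - by exists nx, (h y); rewrite -hx; split=> //; left.
  - by case: hxy; rewrite hx hy; congr Null; apply: rank_inj; rewrite -hx -hy.
pose ren w := if excluded_middle_informative (w = Null n) then v else w.
have renn : ren (Null n) = v by rewrite /ren; case: excluded_middle_informative.
have rene w : w <> Null n -> ren w = w.
  by move=> wn; rewrite /ren; case: excluded_middle_informative.
have vne : v <> Null n by move=> E; rewrite E ltnn in vn.
pose J a := exists a0, inst_of c a0 /\ a = map_atom ren a0.
have step : chase_step (below_bound (bound c)) (EGD b x y) h ren (inst_of c) J.
  by split=> //; exists n, v; split.
have [l [_ lP ltl]] := In_filter (fun w => w <> Null n) (cover c).
have adomJ w : adom J w -> adom (inst_of c) w /\ w <> Null n.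
  case=> a [[a0 [Ia0 ->]] /in_map_atom[u ua ->]].
  case: (classic (u = Null n)) => [->|un]; first by rewrite renn.
  by rewrite rene //; split=> //; exists a0.
exists (Move (EGD b x y) h ren (Config J (bound c) l [::])); split=> //=.
- split=> //=; last exact: step_null dG step (ok_null okc).
    by move=> w /adomJ[wI wn]; apply/lP; split=> //; apply: ok_cover.
  by move=> w /adomJ[wI _]; apply: ok_bound wI.
- move=> w; case: (classic (w = Null n)) => [->|wn]; last by left; apply: rene.
  by right; rewrite renn.
- by move=> _ _; split=> //; apply: (ltl (Null n)); [apply: ok_cover | case].
Qed.

Lemma TGD_move c : ok c -> todo c <> [::] -> exists m, good_move c m.
Proof.
move=> okc; case E: (todo c) => [|[d h] rest] // _.
have act : active_TGD (inst_of c) (d, h) by apply: (ok_todo okc); rewrite E; left.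
have [J [k [l [step kb okJ nact]]]] := apply_TGD okc act.
have [t [le_t tP _]] := In_filter (active_TGD J) rest.
exists (Move d h id (Config J k l t)); split; rewrite ?E //=.
- by case: act.
- by apply: okJ => x /tP[].
- by left.
- move=> _; split=> // x [<- //|xr] xJ; apply/tP; split=> //.
  by have [xG nE _] : active_TGD (inst_of c) x by apply: (ok_todo okc); rewrite E; right.
Qed.

Lemma TGD_triggers c (l : seq dep) : ok c ->
  exists F, forall d h, List.In d l -> trigger d h (inst_of c) ->
    exists2 h', same_trigger d h h' & List.In (d, h') F.
Proof.
move=> okc; elim: l => [|d l [F FP]]; first by exists [::].
have [zs zsP] : finp (in_atoms (body_of d)).
  apply: (finp_sub (Q := fun z => exists2 a, List.In a (body_of d) &
    exists2 i, True & z = aargs a i)).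
    apply: finp_bigU => [|a _]; first exact: finp_In.
    by apply: finp_image; apply: finp_finType.
  by move=> z [a [ahd [i <-]]]; exists a => //; exists i.
have [zs' [_ zs'P _]] := In_filter (in_atoms (body_of d)) zs.
have fin : finp (adom (inst_of c)) by exists (cover c); apply: ok_cover.
have [H HP] := finp_agree (Null (inr 0)) zs' fin.
exists ([seq (d, h) | h <- H] ++ F) => d' h [<-|d'l] trig; last first.
  by have [h' hh' h'F] := FP d' h d'l trig; exists h' => //; apply/In_cat; right.
have [|h' h'H h'E] := HP h.
  by move=> z /zs'P[_ zb]; apply: maps_into_adom trig zb.
exists h'; first by move=> z zb; apply/h'E/zs'P; split=> //; apply: zsP.
by apply/In_cat; left; apply/In_map; exists h'.
Qed.

(** Every move must be a chase step, so refilling is combined with firing one of the triggers found;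
    those still active afterwards are kept. *)
Lemma refill_move c : ok c -> todo c = [::] -> EGD_model (inst_of c) ->
  ~ model Gam (inst_of c) -> exists m, good_move c m.
Proof.
move=> okc c0 mE nm; have [F0 F0P] := TGD_triggers (Gamma R) okc.
have [F [_ FP _]] := In_filter (active_TGD (inst_of c)) F0.
have inF d h : Gam d -> ~ is_EGD d -> active d h (inst_of c) ->
    exists2 h', same_trigger d h h' & List.In (d, h') F.
  move=> dG dE act; have [h' hh' h'F] := F0P d h dG act.1.
  by exists h' => //; apply/FP; split=> //; split=> //; apply: active_same act.
have [d [h [dG act]]] : exists d h, Gam d /\ active d h (inst_of c).
  by apply: NNPP => no; apply: nm => d h dG act; apply: no; exists d, h.
have dE : ~ is_EGD d by move=> dE; apply: mE act.
have [h1 hh1 h1F] := inF d h dG dE act.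
have act1 : active_TGD (inst_of c) (d, h1) by apply: ((FP _).1 h1F).2.
have [J [k [l [step kb okJ nact]]]] := apply_TGD okc act1.
have [t [_ tP _]] := In_filter (active_TGD J) F.
exists (Move d h1 id (Config J k l t)); split=> //=.
- by apply: okJ => x /tP[].
- by left.
move=> _ _ d' h' dG' dE' act' actJ; have [h2 hh2 h2F] := inF d' h' dG' dE' act'.
exists h2 => //; apply/tP; split=> //; split=> //; exact: active_same actJ.
Qed.

Lemma good_move_ex c : ok c -> ~ model Gam (inst_of c) -> exists m, good_move c m.
Proof.
move=> okc nm; case: (classic (todo c = [::])) => c0; last exact: TGD_move.
case: (classic (EGD_model (inst_of c))) => mE; first exact: refill_move.
exact: EGD_move.
Qed.

Variable c0 : config.
Hypotheses (ok0 : ok c0).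

Lemma EGD_fair_sequence_ex : exists s : sequence (rel_schema S) (dvar S) C (Q + nat),
  chase_sequence Gam (inst_of c0) s /\ EGD_fair Gam s.
Proof.
have [next nextP] : exists next : config -> move, forall c,
    ok c -> ~ model Gam (inst_of c) -> good_move c (next c).
  apply: (fun_choice (P := fun c m => ok c -> ~ model Gam (inst_of c) -> good_move c m)) => c.
  case: (classic (ok c /\ ~ model Gam (inst_of c))) => [[okc nm]|no].
    by have [m mP] := good_move_ex okc nm; exists m.
  exists (Move (TGD [::] [::]) (fun=> Null (inr 0)) id c) => okc nm; by case: no.
pose cfg i := iter i (fun c => mv_next (next c)) c0.
(* The sequence stops at the first model, if there is one. *)
have [len lenP] : exists len : option nat,
    if len is Some n then model Gam (inst_of (cfg n)) /\
      forall i, i < n -> ~ model Gam (inst_of (cfg i))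
    else forall i, ~ model Gam (inst_of (cfg i)).
  case: (classic (exists n, model Gam (inst_of (cfg n)))) => [[n mn]|no]; last first.
    by exists None => i mi; apply: no; exists i.
  elim/ltn_ind: n mn => n IH mn.
  case: (classic (exists2 i, i < n & model Gam (inst_of (cfg i)))) => [[i /IH//]|no].
  by exists (Some n); split=> // i ltin mi; apply: no; exists i.
pose s := Sequence len (fun i => inst_of (cfg i)) (fun i => mv_dep (next (cfg i)))
  (fun i => mv_trig (next (cfg i))) (fun i => mv_ren (next (cfg i))).
have nm i : in_seq s i.+1 -> ~ model Gam (inst_of (cfg i)).
  by rewrite /in_seq /=; case: len lenP {s} => [n [_ nmn]|//] /nmn.
have okS i : in_seq s i -> ok (cfg i).
  elim: i => [//|i IH] is_; have okc := IH (in_seq_le (leqnSn i) is_).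
  exact: gm_ok (nextP _ okc (nm i is_)).
have gm i : in_seq s i.+1 -> good_move (cfg i) (next (cfg i)).
  by move=> is_; apply: nextP (nm i is_); apply: okS; apply: in_seq_le is_.
have used i v : in_seq s i -> used_upto s i v -> below_bound (bound (cfg i)) v.
  move=> is_ [j ji vj] n vn; have jn : n < bound (cfg j).
    by apply: (ok_bound (okS j (in_seq_le ji is_)) vj).
  apply: leq_trans jn _; elim: i ji is_ => [|i IH]; first by rewrite leqn0 => /eqP ->.
  rewrite leq_eqVlt => /orP[/eqP->//|ji] is_.
  apply: leq_trans (IH ji _) (gm_bound (gm i is_)); exact: in_seq_le is_.
have inf : len = None -> forall i, in_seq s i by move=> E i; rewrite /in_seq /= E.
have descent : len = None -> forall i, exists j,
    [/\ i <= j, todo (cfg j) = [::] & EGD_model (inst_of (cfg j))].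
  move=> lenN i; have {}gm k := gm k (inf lenN k.+1).
  have [j [ij j0]] : exists j, i <= j /\ todo (cfg j) = [::].
    move E: (size (todo (cfg i))) => n; elim/ltn_ind: n i E => n IH i E.
    case: (classic (todo (cfg i) = [::])) => i0; first by exists i.
    have [lt_n _] := gm_todo (gm i) i0; rewrite E in lt_n.
    by have [j [ij j0]] := IH _ lt_n i.+1 erefl; exists j; split=> //; apply: ltnW.
  move E: (size (cover (cfg j))) => n; elim/ltn_ind: n j E ij j0 => n IH j E ij j0.
  case: (classic (EGD_model (inst_of (cfg j)))) => mE; first by exists j.
  have [j1 lt_n] := gm_EGD (gm j) j0 mE; rewrite E in lt_n.
  by apply: (IH _ lt_n j.+1 erefl) => //; apply: leqW.
exists s; split; last first.
  move=> i is_; case E: len => [n|]; last first.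
    have [j [ij j0 mE]] := descent E i.+1.
    by right; exists j; split=> //; apply: inf.
  have [mn _] : model Gam (inst_of (cfg n)) /\
    forall i, i < n -> ~ model Gam (inst_of (cfg i)) by move: lenP; rewrite E.
  have := is_; rewrite /in_seq /= E leq_eqVlt => /orP[/eqP->|lt_in].
    by left; split=> //; exists n.
  right; exists n; split; [by [] | by rewrite /in_seq /= ?E |].
  by apply: model_sub mn => d [].
split=> //.
- move=> i is_; have m := gm i is_; split; first exact: gm_Gamma m.
  apply: chase_step_used (gm_step m) => v; apply: used; exact: in_seq_le is_.
- move=> i d h is_ dG act; case E: len => [n|].
    exists n; rewrite /in_seq /= ?E; split=> //; first by move: is_; rewrite /in_seq /= E.
    by move: lenP; rewrite E => -[mn _]; apply: mn.
  apply: NNPP => no; have actA k : i <= k -> active d h (inst_of (cfg k)).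
    by move=> ik; apply: NNPP => nact; apply: no; exists k; split=> //; apply: inf.
  have [j [ij j0 mE]] := descent E i.
  have dE : ~ is_EGD d by move=> dE; apply: mE (actA j ij).
  have [h1 hh1 h1t] := gm_refill (gm j (inf E _)) j0 mE dG dE (actA j ij) (actA j.+1 (leqW ij)).
  have todoP k : List.In (d, h1) (todo (cfg (j.+1 + k))) /\
      size (todo (cfg (j.+1 + k))) + k <= size (todo (cfg j.+1)).
    elim: k => [|k [IHin IHle]]; first by rewrite !addn0.
    have k0 : todo (cfg (j.+1 + k)) <> [::] by move=> k0; rewrite k0 in IHin.
    have [lt_k inS] := gm_todo (gm _ (inf E _)) k0; rewrite !addnS; split.
      apply: inS => //=; apply: active_same dE hh1 _; apply: (actA (j.+1 + k).+1).
      by apply: leq_trans ij _; rewrite addSn -!addnS leq_addr.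
    by apply: leq_trans IHle; rewrite ltn_add2r.
  have [_] := todoP (size (todo (cfg j.+1))).+1.
  by rewrite addnS ltnNge leq_addl.
(* Settling: each change of [v] lowers its rank. *)
move=> i v is_ _; move E: (rank (v i)) => r.
elim/ltn_ind: r i is_ E => r IH i is_ E vS.
case: (classic (exists j, [/\ i <= j, in_seq s j & v j <> v i])) => [[j [ij js ne]]|no].
  have lt_r : rank (v j) < r.
    suff [//|] : v j = v i \/ rank (v j) < rank (v i) by rewrite E.
    elim: j ij js {ne} => [|j IHj]; first by rewrite leqn0 => /eqP <-; left.
    rewrite leq_eqVlt => /orP[/eqP<- _|ij js]; first by left.
    have := IHj ij (in_seq_le (leqnSn j) js); rewrite (vS j ij js) /=.
    case: (gm_rank (gm j js) (v j)) => [->//|lt_j [<-|]]; first by right.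
    by move=> lt_i; right; apply: ltn_trans lt_i.
  have [|k [jk ks kP]] := IH _ lt_r j js erefl.
    by move=> l jl; apply: vS; apply: leq_trans jl.
  by exists k; split=> //; apply: leq_trans jk.
exists i; split=> // j ij js; apply: NNPP => ne; apply: no; by exists j.
Qed.

End Existence.

(** * The equivalence *)

Section Encodings.
Variables (S : signature) (C N : Type).

Lemma atom_eta X (f : S) (p : 'I_(arity f).+1 -> X) :
  @Atom (rel_schema S) X f p = rel_atom (fun i => p (lift ord_max i)) (p ord_max).
Proof.
congr Atom; apply: functional_extensionality => i.
by rewrite /snoc; case: unliftP => [j|] ->.
Qed.

Lemma encode_rel (A : automaton S) (i : state A -> N) f q c :
  encode (C := C) i (rel_atom (f := f) q c) <->
  exists p d, [/\ trans A f p d, q = (fun k => Null (i (p k))) & c = Null (i d)].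
Proof.
split; last by case=> p [d [pd -> ->]]; exists f, p, d.
case=> g [p [d [pd E]]].
by apply: (rel_atom_eq (K := fun f q c => exists p d,
  [/\ trans A f p d, q = (fun k => Null (i (p k))) & c = Null (i d)]) E); exists p, d.
Qed.

Lemma encode_hom (A : automaton S) (i : state A -> N) :
  ahom (A := A) (B := vaut (encode (C := C) i)) (fun q => Null (i q)).
Proof. by move=> f p d pd; apply/encode_rel; exists p, d. Qed.

Lemma encode_adom (A : automaton S) (i : state A -> N) v :
  adom (encode (C := C) i) v -> exists q, v = Null (i q).
Proof.
case/adomP=> f [q [c [/encode_rel[p [d [pd -> ->]]] [->|[k ->]]]]].
  by exists d.
by exists (p k).
Qed.

Lemma encode_reached (A : automaton S) (i : state A -> N) : egraph A ->
  reached (encode (C := C) i).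
Proof.
case/egraphP=> _ rA v /encode_adom[q ->]; have [t tq] := rA q.
by exists t; apply: gev_hom (encode_hom i) tq.
Qed.

Lemma encode_null (A : automaton S) (i : state A -> N) : all_null (encode (C := C) i).
Proof. by move=> v /encode_adom[q ->]; exists (i q). Qed.

End Encodings.

(** * E-graphs obtained from instances *)

Section Isomorphism.
Variables (S : signature) (C N : Type).

(** The restriction of [vaut] to the active domain, which removes the unreachable states. *)
Definition iaut (I : instance (rel_schema S) C N) : automaton S :=
  Automaton (state := {v | adom I v})
    (fun f q c => I (rel_atom (fun i => sval (q i)) (sval c))).

Lemma iaut_hom I : ahom (A := iaut I) (B := vaut I) sval.
Proof. by []. Qed.

Lemma iaut_gev I t v (vI : adom I v) :
  gev (A := vaut I) t v -> gev (A := iaut I) t (exist _ v vI).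
Proof.
elim: t v vI => [[]|f a IH] v vI /= [p pv ap].
exists (fun i => exist _ (p i) (adom_arg i pv)) => // i; exact: IH (ap i).
Qed.

Lemma iaut_egraph I : functional (vaut I) -> reached I -> egraph (iaut I).
Proof.
move=> fI rI; apply/egraphP; split=> [f p c c' pc pc'|[v vI]].
  by apply: sig_inj; apply: fI pc pc'.
by have [t tv] := rI v vI; exists t; apply: iaut_gev.
Qed.

Lemma iaut_teq I s t : teq (iaut I) s t <-> teq (vaut I) s t.
Proof.
split=> [[q sq tq]|[v sv tv]].
  by exists (sval q); apply: gev_hom (@iaut_hom I) _.
have vI : adom I v by have [f [q qv]] := gev_output sv; apply: adom_res qv.
by exists (exist _ v vI); apply: iaut_gev.
Qed.

Lemma aiso_encoding (I : instance (rel_schema S) C N) (E : automaton S) :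
  all_null I -> egraph E -> aiso (iaut I) E -> instance_iso I (encoding C E).
Proof.
move=> nI /egraphP[_ rE] [h [g hK gK] hP].
have qE (q : state E) : adom (encoding C E) (Null q).
  have [[[]|f a]] := rE q; case=> p pq _.
  have pqE : encoding C E (rel_atom (fun i => Null (p i)) (Null q)).
    by exists f, p, q.
  exact: adom_res pqE.
exists (fun v => exist _ (Null (h v)) (qE (h v))); split.
- have surj (w : {w | adom (encoding C E) w}) : exists v, w = exist _ (Null (h v)) (qE (h v)).
    case: w => w wE; have [q wq] := encode_adom wE.
    by exists (g q); apply: sig_inj => /=; rewrite gK.
  have [g' g'P] := fun_choice surj; exists g' => [v|w]; last by rewrite -g'P.
  apply: (can_inj hK); have := congr1 sval (g'P (exist _ (Null (h v)) (qE (h v)))).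
  by case.
- by move=> c v; split=> //= vc; have [n] := nI _ (svalP v); rewrite vc.
- move=> f a; rewrite !atom_eta.
  have := hP f (fun i => a (lift ord_max i)) (a ord_max) => /= ->.
  rewrite /encoding encode_rel; split.
    move=> pd; by exists (fun i => h (a (lift ord_max i))), (h (a ord_max)).
  case=> p [d [pd /= pE [->]]].
  suff -> : (fun i => h (a (lift ord_max i))) = p by [].
  apply: functional_extensionality => i.
  by have [] := congr1 (fun k => k i) pE.
Qed.

End Isomorphism.

(** * Chases of the encoded E-graph and finite index *)

Section Main.
Variables (S : signature) (R : seq (rule S)) (G : automaton S) (C : Type).
Hypotheses (eG : egraph G) (finG : finite_states G).

Local Notation I0 := (initial C G).
Local Notation W := (cl R (teq G)).
Local Notation chase := (chase_sequence (in_Gamma R) I0).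

Let I0_reached : reached I0. Proof. exact: encode_reached. Qed.
Let I0_null : all_null I0. Proof. exact: encode_null. Qed.
Let W_per : per W. Proof. exact: cl_per. Qed.
Let W_closed : closed R W. Proof. exact: cl_closed. Qed.

Lemma initial_finite : finp (adom I0).
Proof.
case: finG => l lP; exists [seq Null (inl q) | q <- l] => v /encode_adom[q ->].
by apply/In_map; exists q.
Qed.

(** [phi] is total on values, so a ground term [t0] is needed for those that are not E-classes. *)
Lemma initial_term_hom (t0 : ground S) : exists phi, term_hom W I0 phi.
Proof.
case/egraphP: eG => _ rG; have [rep repP] := fun_choice rG.
exists (fun v => match v with Null (inl q) => rep q | _ => t0 end).
elim/atom_ind=> f q c /encode_rel[p [d [pd -> ->]]].
rewrite map_rel_atom term_inst_rel; apply: cl_base.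
by exists d => //; exists p => // i; apply: repP.
Qed.

Section Sequence.
Variable s : sequence (rel_schema S) (dvar S) C (state G + nat).
Hypothesis s_chase : chase s.

Lemma ch_teq i : in_seq s i -> sub_rel (teq (vaut (ch_inst s i))) W.
Proof.
move=> is_ t u; have [phi] := ch_term_hom s_chase W_per W_closed (initial_term_hom t) is_.
by move=> /(term_hom_teq W_per); apply.
Qed.

Lemma result_functional : functional (vaut (result s)).
Proof.
apply: (model_functional (R := R)); apply: model_sub (result_model s_chase) => d; by case.
Qed.

Lemma result_teq t u : teq (vaut (result s)) t u <-> W t u.
Proof.
split.
  have := result_teq_sub s_chase W_per W_closed (initial_term_hom t); exact.
apply: cl_min.
- exact: teq_per result_functional.
- exact: model_closed (result_model s_chase).
- have [L Lhom] := result_hom0 s_chase => {}t {}u [q tq uq].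
  exists (L (Null (inl q))); apply: gev_hom Lhom _;
    exact: gev_hom (@encode_hom S C _ G inl) _.
Qed.

Lemma result_iso : instance_iso (result s) (encoding C (EqSat R G)).
Proof.
have [eE teqE] := EqSat_P R eG.
have nI : all_null (result s) by apply: result_null s_chase _.
apply: aiso_encoding => //.
have eI : egraph (iaut (result s)).
  by apply: iaut_egraph; [exact: result_functional | exact: result_reached s_chase _].
apply: aiso_teq => // t u.
  by move/iaut_teq/result_teq/teqE.
by move/teqE/result_teq/iaut_teq.
Qed.

Lemma terminating_index : terminating (in_Gamma R) s -> finite_index W.
Proof.
case=> n sn _; have ns : in_seq s n by rewrite /in_seq sn.
(* [rep] needs a default term; if there are no ground terms, the domain of W is empty. *)
case: (classic (inhabited (ground S))) => [[t0]|no]; last first.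
  by exists (fun=> True); [exists [::] => t | move=> t]; case: no.
have [rep repP] : exists rep : value C (state G + nat) -> ground S,
    forall v, adom (ch_inst s n) v -> gev (A := vaut (ch_inst s n)) (rep v) v.
  apply: (fun_choice (P := fun v t => adom (ch_inst s n) v ->
    gev (A := vaut (ch_inst s n)) t v)) => v.
  case: (classic (adom (ch_inst s n) v)) => [va|]; last by exists t0.
  by have [t tv] := ch_reached s_chase I0_reached ns va; exists t.
exists (fun t => exists2 v, adom (ch_inst s n) v & t = rep v).
  exact/finp_image/(ch_finite s_chase initial_finite ns).
move=> t /result_teq[v /gev_eventually[k ks kP] _].
have kn : k <= n by move: ks; rewrite /in_seq sn.
have tv := kP n kn ns.
have va : adom (ch_inst s n) v by have [f [q qv]] := gev_output tv; apply: adom_res qv.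
exists (rep v); first by exists v.
by apply: (ch_teq ns); exists v => //; apply: repP.
Qed.

Lemma index_terminating : finite_index W -> EGD_fair (in_Gamma R) s ->
  terminating (in_Gamma R) s.
Proof.
move=> finW fairE; have [ps [psW psP]] := finite_index_gen W_per finW.
have [k ks kP] : eventually s (fun j => forall p, List.In p ps ->
    teq (vaut (ch_inst s j)) p.1 p.2).
  apply: (eventually_In (P := fun p j => teq (vaut (ch_inst s j)) p.1 p.2)) => p /psW.
  case/result_teq=> v /gev_eventually pv1 /gev_eventually pv2.
  by apply: eventually_mono (eventually_and pv1 pv2) => j _ []; exists v.
case: (fairE k ks) => [[]//|[j [kj js mE]]].
have fj := model_functional mE.
have Wj : sub_rel W (teq (vaut (ch_inst s j))).
  by apply: psP; [apply: teq_per | apply: kP; first exact: ltnW].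
have mj : model (in_Gamma R) (ch_inst s j).
  apply: closed_model => //; first exact (ch_reached s_chase I0_reached js).
  by move=> r sg rR /(ch_teq js) lW; apply/Wj/W_closed.
(* A chase step requires an active trigger, so the sequence cannot go on beyond the model at [j]. *)
exists j => //; case E: (ch_len s) => [n|]; last first.
  have js1 : in_seq s j.+1 by rewrite /in_seq E.
  by have [dG [act _]] := ch_step s_chase js1; case: (mj _ _ dG act).
move: js; rewrite /in_seq E leq_eqVlt => /orP[/eqP-> //|lt_jn].
have js1 : in_seq s j.+1 by rewrite /in_seq E.
by have [dG [act _]] := ch_step s_chase js1; case: (mj _ _ dG act).
Qed.

End Sequence.

Lemma EGD_fair_ex : exists2 s, chase s & EGD_fair (in_Gamma R) s.
Proof.
have [l lP] := finG; have [m [idx [lt_m inj]]] := numbering l.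
(* E-classes get ranks below [m] and fresh nulls follow in order of creation, so the more recent
   null is the one replaced. *)
pose rank (v : value C (state G + nat)) :=
  match v with Null (inl q) => idx q | Null (inr n) => m + n | Const _ => 0 end.
have [l0 l0P] := initial_finite.
have ok0 : ok R (Config I0 0 l0 [::]).
  by split=> // v /encode_adom[q ->] n.
have [|s [cs fs]] := EGD_fair_sequence_ex (rank := rank) _ ok0; last by exists s.
move=> [q|n] [q'|n'] /=.
- by move/(inj _ _ (lP q) (lP q')) => ->.
- by move=> E; have := lt_m q (lP q); rewrite E ltnNge leq_addr.
- by move=> E; have := lt_m q' (lP q'); rewrite -E ltnNge leq_addr.
- by move/addnI => ->.
Qed.

End Main.

Theorem theorem30 (S : signature) (R : seq (rule S)) (G : automaton S)
    (C : Type) (HG : egraph G) (Gfin : finite_states G) :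
  ((eqsat_terminates R G <->
    exists s, chase_sequence (in_Gamma R) (initial C G) s /\
              terminating (in_Gamma R) s) /\
   ((exists s, chase_sequence (in_Gamma R) (initial C G) s /\
               terminating (in_Gamma R) s) <->
    (forall s, chase_sequence (in_Gamma R) (initial C G) s ->
               EGD_fair (in_Gamma R) s -> terminating (in_Gamma R) s))) /\
  (eqsat_terminates R G ->
   forall s, chase_sequence (in_Gamma R) (initial C G) s ->
             instance_iso (result s) (encoding C (EqSat R G))).
Proof.
(* Statement 3 might hold vacuously if there were no such sequence. *)
have [s0 cs0 fs0] := EGD_fair_ex R C Gfin.
have indexE := eqsat_terminates_index R HG Gfin.
split; last by move=> _ s; apply: result_iso.
split; split.
- move=> /indexE finW; exists s0; split=> //; exact: index_terminating finW fs0.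
- by case=> s [cs ts]; apply/indexE; apply: terminating_index cs ts.
- case=> s [cs ts] s' cs'; apply: index_terminating => //.
  exact: terminating_index cs ts.
- by move=> all; exists s0; split=> //; apply: all.
Qed.
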